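(* Let $X=\{X(t):t\in\mathbb{R}\}$ be a Lévy process with $X(0)=0$ and $\mathbb{E}X(1)=0$. Let $\phi(\vartheta)=\log\mathbb{E}e^{\vartheta X(1)}$ and $\beta^\star=\sup\{\beta:\mathbb{E}e^{\beta X(1)}<\infty\}$. Assume that $\beta^\star>0$ and that there exists $\vartheta^\star\in(0,\beta^\star)$ such that $\phi(\vartheta^\star)=\vartheta^\star$. For $r\ge0$ let $I(r)=\sup_{\vartheta>0}(\vartheta r-\phi(\vartheta))$. Let $Y(t)=X(t)-t$, $Q(t)=\sup_{s\le t}(Y(t)-Y(s))$ for $t\ge0$, and $M(t)=\inf_{s\in[0,t]}Q(s)$. Let $u\mapsto T_u$ be a nonnegative function of $u>0$. Then, as $u\to\infty$, \[ \log\mathbb{P}(M(T_u)>u)\sim-u\,\vartheta^\star-T_u\,I(1). \]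
   Context: A Lévy process indexed by $\mathbb{R}$ is a càdlàg process with stationary independent increments and $X(0)=0$. The supremum defining $Q(t)$ is over all real $s\le t$, so that $Q$ is a stationary process. The notation $f(u)\sim g(u)$ as $u\to\infty$ means $f(u)/g(u)\to1$. *)

(* Defs.v *)
From HB Require Import structures.
From mathcomp Require Import all_boot all_order all_algebra.
From mathcomp Require Import all_classical all_reals all_analysis.

Set Implicit Arguments.
Unset Strict Implicit.
Unset Printing Implicit Defensive.

Import Order.TTheory GRing.Theory Num.Theory.
Import numFieldNormedType.Exports.

Local Open Scope classical_set_scope.
Local Open Scope ring_scope.
Local Open Scope ereal_scope.

Definition cadlag (R : realType) (f : R -> R) : Prop :=
  forall t : R, f s @[s --> t^'+] --> f t /\ cvg (f s @[s --> t^'-]).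

(* Taking [A i := setT] for some of the indices yields the product rule for
   every subfamily. *)
Definition mutually_independent (d : measure_display)
    (Omega : measurableType d) (R : realType) (P : probability Omega R)
    (n : nat) (Z : 'I_n -> Omega -> R) : Prop :=
  forall A : 'I_n -> set R, (forall i, measurable (A i)) ->
    P [set w | forall i, A i (Z i w)] = \prod_(i < n) P [set w | A i (Z i w)].

Record levy_process (d : measure_display) (Omega : measurableType d)
    (R : realType) (P : probability Omega R) (X : R -> {RV P >-> R}) : Prop := {
  levy_start0 : forall w, X 0%R w = 0%R ;
  levy_cadlag : forall w, cadlag (fun t => X t w) ;
  levy_stationary : forall (s t h : R) (A : set R), (0 <= h)%R -> measurable A ->
    P [set w | A (X (s + h)%R w - X s w)%R] =
    P [set w | A (X (t + h)%R w - X t w)%R] ;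
  levy_independent : forall (n : nat) (t : nat -> R), nondecreasing_seq t ->
    mutually_independent P
      (fun (i : 'I_n) w => (X (t i.+1) w - X (t i) w)%R) }.

Section LevyQueue.
Context (d : measure_display) (Omega : measurableType d) (R : realType)
  (P : probability Omega R) (X : R -> {RV P >-> R}).

(* [lne +oo = +oo], so [cumulant th = +oo] when the moment generating function
   of [X 1] is infinite at [th]. *)
Definition cumulant (th : R) : \bar R := lne ('M_P (X 1%R) th).

Definition beta_star : \bar R :=
  ereal_sup [set b%:E | b in [set b : R | 'M_P (X 1%R) b < +oo]].

Definition rate (r : R) : \bar R :=
  ereal_sup [set (th * r)%:E - cumulant th | th in [set th : R | (0 < th)%R]].

Definition net_input (t : R) (w : Omega) : R := (X t w - t)%R.

Definition workload (t : R) (w : Omega) : \bar R :=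
  ereal_sup [set (net_input t w - net_input s w)%:E
            | s in [set s : R | (s <= t)%R]].

Definition min_workload (t : R) (w : Omega) : \bar R :=
  ereal_inf [set workload s w | s in [set s : R | (0 <= s <= t)%R]].

End LevyQueue.

(* The library relation [~_] needs values in a normed module, hence the quotient:
   here [f] may take the value [-oo], as the logarithm of a null probability,
   in which case [f u / g u = +oo] when [g u] is finite and negative. *)
Definition asymp_equiv (R : realType) (f g : R -> \bar R) : Prop :=
  f u / g u @[u --> +oo%R] --> 1.

(* Main.v *)
(** A workload that stays above [u >= 0] on [[0, T]] has never emptied, so that it
    is [Q 0 + Y] there: [M T > u] amounts to [Q 0 + Y > u] on
    [[0, T]], with [Q 0] and [Y] independent.  Let [L x] be the moment generating
    function of [Y 1], so that [L theta_star = 1] and [rate 1 = - ln (inf L)].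

    Upper bound: [M T > u] forces [Q 0 > max u (u - Y n)] for [n] the integer part
    of [T]; Lundberg's bound [P (Q 0 > v) <= expR (- theta_star * v)], integrated
    over the law of [Y n], gives [expR (- theta_star * u) * L x ^+ n] for every [x]
    in [[0, theta_star]].  No error term depends on [T], hence the uniformity.

    Lower bound: start from [Q 0 > u + K + 1] and repeat blocks of fixed length [N]
    during which [Y] stays above [- K] and ends above its starting point.  Both
    probabilities come from Cramer's lower bound, where the exponential tilting is
    done at [theta_star] for [Q 0], and next to the minimiser of [L] for the blocks.

    Instead of derivatives of [L], the tilting uses that halving [h] divides the
    second difference [L (x + h) + L (x - h) - 2 * L x] by at least 4, so that the
    left and right difference quotients of [L] get arbitrarily close. *)

Require Import Defs.
From HB Require Import structures.
From mathcomp Require Import all_boot all_order all_algebra.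
From mathcomp Require Import all_classical all_reals all_analysis.
From mathcomp Require Import measurable_realfun.
From mathcomp Require Import ring lra.

Set Implicit Arguments.
Unset Strict Implicit.
Unset Printing Implicit Defensive.

Import Order.TTheory GRing.Theory Num.Theory.
Import numFieldNormedType.Exports.

Local Open Scope classical_set_scope.
Local Open Scope ring_scope.
Local Open Scope ereal_scope.

(** * Independence and cylinder events *)

Section Independence.
Context (d : measure_display) (Omega : measurableType d) (R : realType)
  (P : probability Omega R).

(** The supremum and the infimum run over uncountable sets of times, whereas independence is a
    product rule for finitely many increments. Both bounds are therefore proved on dyadic grids,
    with constants that depend neither on the mesh nor on the horizon, and then passed to the limit
    by monotone continuity of [P]; right-continuity of the paths makes dyadic times sufficient.

    Confining the parameter of the upper bound to [[0, theta_star]] loses nothing: as [L] is convex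
    with [L 0 = L theta_star = 1], it is at least 1 beyond [theta_star]. The assumption that
    [theta_star] lies strictly below [beta_star] yields some [b > theta_star] with a finite moment,
    which leaves room on both sides for the tilt at [theta_star].

    As [T] is arbitrary, the exponent may only suffer additive constants and a factor [1 + e]; both
    are harmless because the exponent is at least [theta_star * u]. *)

Definition indep d1 d2 (T1 : measurableType d1) (T2 : measurableType d2)
    (U : Omega -> T1) (V : Omega -> T2) : Prop :=
  forall A B, measurable A -> measurable B ->
    P (U @^-1` A `&` V @^-1` B) = P (U @^-1` A) * P (V @^-1` B).

Lemma measurable_preimage d1 (T1 : measurableType d1) (U : Omega -> T1) A :
  measurable_fun setT U -> measurable A -> measurable (U @^-1` A).
Proof. by move=> mU mA; rewrite -[_ @^-1` _]setTI; exact: mU. Qed.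

Lemma law_unique d1 (T1 : measurableType d1) (G : set (set T1))
    (U V : Omega -> T1) :
  measurable = <<s G >> -> setI_closed G -> G setT ->
  measurable_fun setT U -> measurable_fun setT V ->
  (forall A, G A -> P (U @^-1` A) = P (V @^-1` A)) ->
  forall A, measurable A -> P (U @^-1` A) = P (V @^-1` A).
Proof.
move=> mG GI GT mU mV UV A mA.
pose U' : {mfun Omega >-> T1} := mfun_Sub (mem_set mU).
pose V' : {mfun Omega >-> T1} := mfun_Sub (mem_set mV).
apply: (@measure_unique _ R _ G (fun=> setT) mG GI _ _
  (distribution P U') (distribution P V') UV _ A mA) => //.
- by rewrite bigcup_const //; exists 0%N.
- by move=> _; rewrite [X in X < _]probability_setT ltry.
Qed.

(** For fixed [F] both sides are finite measures in [A]: the law of [U] under [P] restricted to [F],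
    and the law of [U] scaled by [P F]. They agree on a generating pi-system. *)
Lemma indep_event d1 (T1 : measurableType d1) (G : set (set T1))
    (U : Omega -> T1) (F : set Omega) :
  measurable = <<s G >> -> setI_closed G -> G setT ->
  measurable_fun setT U -> measurable F ->
  (forall A, G A -> P (U @^-1` A `&` F) = P (U @^-1` A) * P F) ->
  forall A, measurable A -> P (U @^-1` A `&` F) = P (U @^-1` A) * P F.
Proof.
move=> mG GI GT mU mF UF A mA.
pose r : {nonneg R} := NngNum (fine_ge0 (measure_ge0 P F)).
have rE : r%:num%:E = P F by rewrite /= fineK// fin_num_measure.
pose U' : {mfun Omega >-> T1} := mfun_Sub (mem_set mU).
pose m1_ : {measure set T1 -> \bar R} := pushforward (mrestr P mF) U'.
pose m1 := m1_ mU.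
pose m2 : {measure set T1 -> \bar R} := mscale r (distribution P U').
have -> : P (U @^-1` A) * P F = m2 A by rewrite /m2 /= /mscale rE muleC.
rewrite -[LHS]/(m1 A).
apply: (@measure_unique _ R _ G (fun=> setT) mG GI _ _ m1 m2 _ _ A mA) => //.
- by rewrite bigcup_const //; exists 0%N.
- by move=> B GB; rewrite /m1 /m1_ /m2 /= /mscale rE muleC; exact: UF.
- move=> _; rewrite -ge0_fin_numE// /m1 /m1_ /= /pushforward /mrestr.
  by rewrite preimage_setT setTI fin_num_measure.
Qed.

Lemma indep_generated d1 d2 (T1 : measurableType d1) (T2 : measurableType d2)
    (G1 : set (set T1)) (G2 : set (set T2)) (U : Omega -> T1) (V : Omega -> T2) :
  measurable = <<s G1 >> -> setI_closed G1 -> G1 setT ->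
  measurable = <<s G2 >> -> setI_closed G2 -> G2 setT ->
  measurable_fun setT U -> measurable_fun setT V ->
  (forall A B, G1 A -> G2 B ->
     P (U @^-1` A `&` V @^-1` B) = P (U @^-1` A) * P (V @^-1` B)) ->
  indep U V.
Proof.
move=> mG1 G1I G1T mG2 G2I G2T mU mV UV A B mA mB.
apply: (indep_event mG1) => //; first exact: measurable_preimage.
move=> {mA} {}A GA; rewrite setIC muleC.
apply: (indep_event mG2) => //.
- by apply: measurable_preimage => //; rewrite mG1; exact: sub_gen_smallest.
- by move=> {mB} {}B GB; rewrite setIC muleC UV.
Qed.

Lemma indep_comp d1 d2 d3 d4 (T1 : measurableType d1) (T2 : measurableType d2)
    (T3 : measurableType d3) (T4 : measurableType d4)
    (U : Omega -> T1) (V : Omega -> T2) (f : T1 -> T3) (g : T2 -> T4) :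
  measurable_fun setT f -> measurable_fun setT g ->
  indep U V -> indep (f \o U) (g \o V).
Proof.
move=> mf mg UV A B mA mB; apply: (UV (f @^-1` A) (g @^-1` B)).
- by rewrite -[_ @^-1` _]setTI; exact: mf.
- by rewrite -[_ @^-1` _]setTI; exact: mg.
Qed.

(** The joint law of [(U, V)] is the product of the two laws, so Tonelli applies on the product and
    the result is pulled back to [Omega]. *)
Lemma integral_indep d1 d2 (T1 : measurableType d1) (T2 : measurableType d2)
    (U : Omega -> T1) (V : Omega -> T2) (f : T1 * T2 -> \bar R) :
  measurable_fun setT U -> measurable_fun setT V -> indep U V ->
  measurable_fun [set: (T1 * T2)%type] f -> (forall x, 0 <= f x) ->
  \int[P]_w f (U w, V w) = \int[P]_v \int[P]_w f (U w, V v).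
Proof.
move=> mU mV UV mf f0.
pose U' : {mfun Omega >-> T1} := mfun_Sub (mem_set mU).
pose V' : {mfun Omega >-> T2} := mfun_Sub (mem_set mV).
have mW : measurable_fun setT (fun w => (U w, V w)) by exact: measurable_fun_pair.
pose W : {mfun Omega >-> (T1 * T2)%type} := mfun_Sub (mem_set mW).
have E1 : \int[P]_w f (U w, V w) = \int[distribution P W]_x f x.
  by rewrite ge0_integral_distribution.
rewrite E1; have E2 : \int[distribution P W]_x f x =
    \int[distribution P U' \x distribution P V']_x f x.
  apply: eq_measure_integral => A mA _; apply/esym.
  apply: product_measure_unique => [A1 B1 mA1 mB1/=|//].
  exact: (UV A1 B1 mA1 mB1).
rewrite E2 fubini_tonelli2// ge0_integral_distribution; last 2 first.
- exact: measurable_fun_fubini_tonelli_G.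
- by move=> y; apply: integral_ge0.
apply: eq_integral => v _ /=; rewrite /fubini_G ge0_integral_distribution//.
by apply: measurableT_comp => //; exact: measurable_pair2.
Qed.

End Independence.

Section Cylinders.
Variable R : realType.

(* Real sequences with the sigma-algebra of their first [n] coordinates: the
   carrier does not depend on [n], so concatenation and shift need no casts. *)
Definition cylinder (n : nat) : set (set (nat -> R)) :=
  [set C | exists2 A : nat -> set R, (forall i, measurable (A i)) &
    C = [set z | forall i, (i < n)%N -> A i (z i)]].

Definition seqspace (n : nat) := g_sigma_algebraType (cylinder n).

Lemma measurable_seqspaceE n :
  @measurable _ (seqspace n) = <<s cylinder n >>.
Proof. by []. Qed.

Lemma cylinderI n : setI_closed (cylinder n).
Proof.
move=> _ _ [A mA ->] [B mB ->]; exists (fun i => A i `&` B i).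
  by move=> i; exact: measurableI.
apply/seteqP; split => [z [Az Bz] i ni|z ABz]; first by split; [exact: Az|exact: Bz].
by split=> i ni; have [] := ABz i ni.
Qed.

Lemma cylinderT n : cylinder n setT.
Proof. by exists (fun=> setT) => //; apply/seteqP; split. Qed.

Lemma measurable_coord n i : (i < n)%N ->
  measurable_fun [set: seqspace n] (fun z : seqspace n => z i).
Proof.
move=> ni _ A mA; rewrite setTI; apply: sub_gen_smallest.
exists (fun j => if j == i then A else setT); first by move=> j; case: ifP.
apply/seteqP; split => [z Az j nj /=|z /(_ _ ni)/=]; last by rewrite eqxx.
by case: eqP => [->|].
Qed.

Lemma measurable_fun_seqspace d (T : measurableType d) n (f : T -> seqspace n) :
  (forall i, (i < n)%N -> measurable_fun setT (fun x => f x i)) ->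
  measurable_fun setT f.
Proof.
move=> mf; apply: (@measurability _ _ _ _ setT f (cylinder n)) => //.
move=> _ [_ [A mA ->] <-]; rewrite setTI.
rewrite (_ : _ @^-1` _ = \bigcap_(i < n) ((fun x => f x i) @^-1` (A i))).
  apply: bigcap_measurableType => i ni.
  by rewrite -[_ @^-1` _]setTI; apply: mf.
by apply/seteqP; split => x /= fA i ni; exact: fA.
Qed.

End Cylinders.
Arguments cylinder : clear implicits.
Arguments seqspace : clear implicits.

(** * Increments of a Levy process *)

Section LevyIncrements.
Context (d : measure_display) (Omega : measurableType d) (R : realType)
  (P : probability Omega R) (X : R -> {RV P >-> R}).
Hypothesis levyX : levy_process X.

Local Notation Y := (net_input X).

Lemma measurable_net_input t : measurable_fun setT (Y t).
Proof. by apply: measurable_funB => //; exact: measurable_cst. Qed.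

Definition increments (t : nat -> R) (w : Omega) (i : nat) : R :=
  Y (t i.+1) w - Y (t i) w.

Lemma measurable_increments n t :
  measurable_fun setT (increments t : Omega -> seqspace R n).
Proof.
apply: measurable_fun_seqspace => i _.
by apply: measurable_funB; exact: measurable_net_input.
Qed.

Lemma incrementsE t w i :
  increments t w i = (X (t i.+1) w - X (t i) w - (t i.+1 - t i))%R.
Proof. by rewrite /increments /net_input; ring. Qed.

Lemma measurable_shift (A : set R) c :
  measurable A -> measurable [set x : R | A (x - c)%R].
Proof.
move=> mA; rewrite (_ : [set _ | _] = (fun x : R => x - c)%R @^-1` A)//.
rewrite -[_ @^-1` _]setTI.
by apply: (measurable_funB (@measurable_id _ _ setT) (measurable_cst c)).
Qed.

Lemma increments_cylinder n t (A : nat -> set R) :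
  nondecreasing_seq t -> (forall i, measurable (A i)) ->
  P [set w | forall i, (i < n)%N -> A i (increments t w i)] =
  \prod_(i < n) P [set w | A i (increments t w i)].
Proof.
move=> ndt mA.
(* The increments of [Y] and [X] differ by the deterministic length of the step, so an event on the
   former is a translated event on the latter. *)
pose B (i : 'I_n) : set R := [set x | A i (x - (t i.+1 - t i))%R].
have mB i : measurable (B i) by exact: measurable_shift.
have := levy_independent levyX ndt mB => H.
transitivity (P [set w | forall i : 'I_n, B i (X (t i.+1) w - X (t i) w)%R]).
  congr (P _); apply/seteqP; split => w /= Aw.
    by move=> i; rewrite /B /= -incrementsE; exact: Aw.
  by move=> i ni; have := Aw (Ordinal ni); rewrite /B /= -incrementsE.
rewrite H; apply: eq_bigr => i _; congr (P _); apply/seteqP.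
by split => w; rewrite /B /= -incrementsE.
Qed.

Lemma increments_stationary (s t h : R) (A : set R) : (0 <= h)%R ->
  measurable A ->
  P [set w | A (Y (s + h)%R w - Y s w)%R] =
  P [set w | A (Y (t + h)%R w - Y t w)%R].
Proof.
move=> h0 mA; pose B : set R := [set x | A (x - h)%R].
have E r : [set w | A (Y (r + h)%R w - Y r w)%R] =
           [set w | B (X (r + h)%R w - X r w)%R].
  apply/seteqP; split => w; rewrite /B /=; set a := (X in A X);
    set b := (X in _ -> A X); suff -> : a = b by [];
    by rewrite /a /b /net_input; ring.
by rewrite !E; apply: levy_stationary => //; exact: measurable_shift.
Qed.

(** Two cylinders over consecutive blocks form one cylinder over the concatenated block, where the
    product rule splits; cylinders being a pi-system, this extends to all events of the two
    blocks. *)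
Lemma increments_indep k n t : nondecreasing_seq t ->
  indep P (increments t : Omega -> seqspace R k)
          (increments (fun i => t (k + i)%N) : Omega -> seqspace R n).
Proof.
move=> ndt; apply: (indep_generated (measurable_seqspaceE R k) (@cylinderI R k)
  (@cylinderT R k) (measurable_seqspaceE R n) (@cylinderI R n) (@cylinderT R n)
  (@measurable_increments k t) (@measurable_increments n _)).
move=> _ _ [A mA ->] [B mB ->].
have ndt' : nondecreasing_seq (fun i => t (k + i)%N).
  by move=> i j ij; apply: ndt; rewrite leq_add2l.
rewrite [in RHS](increments_cylinder k ndt mA) (increments_cylinder n ndt' mB).
pose C i := if (i < k)%N then A i else B (i - k)%N.
have mC i : measurable (C i) by rewrite /C; case: ifP.
transitivity (P [set w | forall i, (i < k + n)%N -> C i (increments t w i)]).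
  congr (P _); apply/seteqP; split => w /=.
    move=> [Aw Bw] i ikn; rewrite /C; case: ltnP => ik; first exact: Aw.
    have := Bw (i - k)%N; rewrite /increments addnS subnKC//; apply.
    by rewrite ltn_subLR.
  move=> Cw; split => i ilt.
    by have := Cw i (ltn_addr _ ilt); rewrite /C ilt.
  have := Cw (k + i)%N; rewrite ltn_add2l ilt /C ltnNge leq_addr /= addKn.
  by rewrite /increments addnS; exact.
rewrite increments_cylinder// big_split_ord/=; congr (_ * _).
  by apply: eq_bigr => i _; rewrite /C ltn_ord.
apply: eq_bigr => i _; rewrite /C ltnNge leq_addr /= addKn.
by rewrite /increments addnS.
Qed.

Lemma increments_law n t t' : nondecreasing_seq t -> nondecreasing_seq t' ->
  (forall i, (i < n)%N -> t i.+1 - t i = t' i.+1 - t' i)%R ->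
  forall A : set (seqspace R n), measurable A ->
    P (increments t @^-1` A) = P (increments t' @^-1` A).
Proof.
move=> ndt ndt' tt'.
apply: (law_unique (measurable_seqspaceE R n) (@cylinderI R n) (@cylinderT R n)
  (@measurable_increments n t) (@measurable_increments n t')).
move=> _ [A mA ->].
rewrite (increments_cylinder n ndt mA) (increments_cylinder n ndt' mA).
apply: eq_bigr => i _; rewrite /increments.
have h0 : (0 <= t i.+1 - t i)%R by rewrite subr_ge0; exact: ndt.
have := increments_stationary (t i) (t' i) h0 (mA i).
by rewrite {2}tt'// !(addrC _ (_ - _))%R !subrK.
Qed.

End LevyIncrements.

(** * Exponential moments and the Lindley recursion *)

Section ProbIndep.
Context (d : measure_display) (Omega : measurableType d) (R : realType)
  (P : probability Omega R).

(** This replaces conditioning on [V]: the bound [g] on the sections of [D] is integrated against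
    the law of [V]. *)
Lemma probability_indep_le (U V : Omega -> R) (D : set (R * R))
    (g : R -> \bar R) :
  measurable_fun setT U -> measurable_fun setT V -> indep P U V ->
  measurable D -> measurable_fun setT g -> (forall y, 0 <= g y) ->
  (forall y, P [set w | D (U w, y)] <= g y) ->
  P [set w | D (U w, V w)] <= \int[P]_w g (V w).
Proof.
move=> mU mV UV mD mg g0 Dg.
have mUD y : measurable [set w | D (U w, y)].
  have mf : measurable_fun setT (fun w => (U w, y)) by exact: measurable_fun_pair.
  by rewrite -[[set _ | _]]setTI; exact: mf.
have mUVD : measurable [set w | D (U w, V w)].
  have mf : measurable_fun setT (fun w => (U w, V w)) by exact: measurable_fun_pair.
  by rewrite -[[set _ | _]]setTI; exact: mf.
have m1D : measurable_fun [set: (R * R)%type] (fun x => (\1_D x : R)%:E).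
  by apply/measurable_EFinP; exact: measurable_indic.
rewrite -[X in P X]setIT -integral_indic//.
rewrite -[X in X <= _]/(\int[P]_w ((\1_D (U w, V w) : R)%:E)).
have D0 x : 0 <= (\1_D x : R)%:E by rewrite lee_fin.
rewrite (integral_indep mU mV UV m1D)//.
apply: ge0_le_integral => //.
- by move=> v _; apply: integral_ge0 => w _; exact: D0.
- have := measurable_fun_fubini_tonelli_G (m1 := P) (fun x : Omega * Omega => (\1_D (U x.1, V x.2) : R)%:E).
  apply => //.
  apply/measurable_EFinP; apply: measurableT_comp => //.
  by apply: measurable_fun_pair; exact: measurableT_comp.
- by exact: measurableT_comp.
- move=> v _.
  rewrite -[X in X <= _]/(\int[P]_w ((\1_[set w | D (U w, V v)] w : R)%:E)).
  by rewrite integral_indic// setIT; exact: Dg.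
Qed.

Lemma measurable_expRM d' (T : measurableType d') (th : R) (f : T -> R) :
  measurable_fun setT f -> measurable_fun setT (fun w => (expR (th * f w))%:E).
Proof.
move=> mf; apply/measurable_EFinP; apply: measurableT_comp => //.
by apply: measurableT_comp => //; exact: mulrl_measurable.
Qed.

Lemma integral_expRD_indep (U V : Omega -> R) (th : R) :
  measurable_fun setT U -> measurable_fun setT V -> indep P U V ->
  \int[P]_w (expR (th * (U w + V w)))%:E =
  \int[P]_w (expR (th * U w))%:E * \int[P]_w (expR (th * V w))%:E.
Proof.
move=> mU mV UV.
rewrite (integral_indep (f := fun x : R * R => (expR (th * (x.1 + x.2)))%:E) mU mV UV)//; last first.
  by apply: measurable_expRM; exact: measurable_funD.
set a := \int[P]_w (expR (th * U w))%:E.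
have a0 : 0 <= a by apply: integral_ge0 => w _; rewrite lee_fin expR_ge0.
rewrite -[RHS]ge0_integralZl//; last exact: measurable_expRM.
apply: eq_integral => v _ /=; rewrite muleC /a -ge0_integralZl//; last exact: measurable_expRM.
by apply: eq_integral => w _; rewrite -EFinM -expRD addrC -mulrDr.
Qed.

End ProbIndep.

Section MgfIncrements.
Context (d : measure_display) (Omega : measurableType d) (R : realType)
  (P : probability Omega R) (X : R -> {RV P >-> R}).
Hypothesis levyX : levy_process X.

Local Notation Y := (net_input X).

(** Kept in [\bar R], so that multiplicativity in [t] needs no integrability. *)
Definition mgf_net (t th : R) : \bar R := \int[P]_w (expR (th * Y t w))%:E.

Lemma mgf_net_ge0 t th : 0 <= mgf_net t th.
Proof. by apply: integral_ge0 => w _; rewrite lee_fin expR_ge0. Qed.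

Lemma net_input0 w : Y 0 w = 0%R.
Proof. by rewrite /net_input (levy_start0 levyX) subr0. Qed.

Lemma integral_increment s t th : (s <= t)%R ->
  \int[P]_w (expR (th * (Y t w - Y s w)))%:E = mgf_net (t - s) th.
Proof.
move=> st.
have mD : measurable_fun setT (fun w => Y t w - Y s w)%R.
  by apply: measurable_funB; exact: measurable_net_input.
pose U : {mfun Omega >-> R} := mfun_Sub (mem_set mD).
pose V : {mfun Omega >-> R} := mfun_Sub (mem_set (measurable_net_input X (t - s))).
have me : measurable_fun setT (fun x : R => (expR (th * x))%:E).
  exact: measurable_expRM.
transitivity (\int[distribution P U]_x (expR (th * x))%:E).
  by rewrite ge0_integral_distribution.
transitivity (\int[distribution P V]_x (expR (th * x))%:E); last first.
  by rewrite ge0_integral_distribution.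
apply: eq_measure_integral => A mA _.
have ts0 : (0 <= t - s)%R by rewrite subr_ge0.
have := increments_stationary levyX s 0 ts0 mA.
rewrite subrKC add0r => sA.
rewrite -[RHS]/(P [set w | A (Y (t - s) w)]) -[LHS]/(P [set w | A (Y t w - Y s w)%R]) sA.
by congr (P _); apply/seteqP; split => w; rewrite /= net_input0 subr0.
Qed.

Lemma increments_indep_next k t (f : seqspace R k -> R) : nondecreasing_seq t ->
  measurable_fun setT f ->
  indep P (fun w => f (increments X t w)) (fun w => increments X t w k).
Proof.
move=> ndt mf.
have := indep_comp mf (@measurable_coord R 1 0 (ltn0Sn 0)) (@increments_indep _ _ _ _ _ levyX k 1 t ndt).
by rewrite /comp /increments addn0 addn1.
Qed.

Lemma mgf_netD a b th : (0 <= a)%R -> (0 <= b)%R ->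
  mgf_net (a + b) th = mgf_net a th * mgf_net b th.
Proof.
move=> a0 b0.
pose t (i : nat) := if i is i'.+1 then (if i' is 0%N then a else (a + b)%R) else 0%R : R.
have ndt : nondecreasing_seq t.
  by apply/nondecreasing_seqP => -[|[|n]]//=; rewrite lerDl.
pose U w := increments X t w 0.
pose V w := increments X t w 1.
have mU : measurable_fun setT U by apply: measurable_funB; exact: measurable_net_input.
have mV : measurable_fun setT V by apply: measurable_funB; exact: measurable_net_input.
have UV : indep P U V.
  exact: (increments_indep_next ndt (@measurable_coord R 1 0 (ltn0Sn 0))).
rewrite /mgf_net (eq_integral (fun w => (expR (th * (U w + V w)))%:E)); last first.
  move=> w _; congr (expR (_ * _))%:E.
  by rewrite /U /V /increments /= net_input0; ring.
rewrite (integral_expRD_indep th mU mV UV); congr (_ * _).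
  by apply: eq_integral => w _; rewrite /U /increments /= net_input0 subr0.
have aab : (a <= a + b)%R by rewrite lerDl.
by have := integral_increment th aab; rewrite addrAC subrr add0r.
Qed.

Lemma mgf_net0 th : mgf_net 0 th = 1.
Proof.
rewrite /mgf_net; under eq_integral do rewrite net_input0 mulr0 expR0.
by rewrite integral_cst//= mul1e probability_setT.
Qed.

Lemma mgf_net_natmul n t th : (0 <= t)%R ->
  mgf_net (n%:R * t) th = mgf_net t th ^+ n.
Proof.
move=> t0; elim: n => [|n IH]; first by rewrite mul0r mgf_net0.
have -> : (n.+1%:R * t = t + n%:R * t)%R by rewrite -natr1; ring.
by rewrite mgf_netD ?mulr_ge0// IH expeS.
Qed.

(** The random walk reflected at 0 and started empty. Along [increments X t] it is the maximum of
    [Y (t n) - Y (t k)] over [k <= n]: the workload at [t n] when only starting times on the grid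
    count. *)
Fixpoint lindley (n : nat) (z : nat -> R) : R :=
  if n is m.+1 then Num.max (lindley m z + z m)%R 0%R else 0%R.

Lemma measurable_lindley n m : (n <= m)%N ->
  measurable_fun setT (lindley n : seqspace R m -> R).
Proof.
elim: n => [|n IH] nm; first exact: measurable_cst.
apply: measurable_maxr; last exact: measurable_cst.
by apply: measurable_funD; [apply: IH; exact: ltnW|exact: measurable_coord].
Qed.

(** The induction for nonnegative levels evaluates the bound at [v - y] with [y] of either sign, so
    negative levels are needed too; there the right-hand side is at least 1. *)
Lemma lindley_tail_lt0 n (t : nat -> R) (th v : R) : (0 <= th)%R -> (v < 0)%R ->
  P [set w | v < lindley n (increments X t w)]%R <= (expR (- (th * v)))%:E.
Proof.
move=> th0 v0; apply: (@le_trans _ _ 1).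
  apply: probability_le1; rewrite -[[set _ | _]]setTI; apply: measurable_fun_ltr => //.
  apply: (measurableT_comp (measurable_lindley (leqnn n))).
  exact: measurable_increments.
by rewrite lee_fin -[leLHS]expR0 ler_expR -mulrN mulr_ge0// oppr_ge0 ltW.
Qed.

(* Lundberg's bound, by induction along the recursion instead of a stopped
   martingale. *)
Lemma lindley_tail n (t : nat -> R) (th v : R) : (0 <= th)%R -> nondecreasing_seq t ->
  (forall i, (i < n)%N -> mgf_net (t i.+1 - t i) th <= 1) ->
  P [set w | v < lindley n (increments X t w)]%R <= (expR (- (th * v)))%:E.
Proof.
move=> th0 ndt; elim: n v => [|n IH] v mgf1.
  have /orP[v0|v0] : (v < 0)%R || (0 <= v)%R by case: ltP.
    exact: (lindley_tail_lt0 0).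
  rewrite [X in P X](_ : _ = set0) ?measure0 ?lee_fin ?expR_ge0//.
  by apply/seteqP; split => // w /=; rewrite ltNge v0.
have /orP[v0|v0] : (v < 0)%R || (0 <= v)%R by case: ltP.
  exact: lindley_tail_lt0.
set U := fun w => lindley n (increments X t w).
set V := fun w => increments X t w n.
have mU : measurable_fun setT U.
  apply: (measurableT_comp (measurable_lindley (leqnn n))).
  exact: measurable_increments.
have mV : measurable_fun setT V by apply: measurable_funB; exact: measurable_net_input.
pose D := [set x : R * R | v < x.1 + x.2]%R.
have mD : measurable D.
  by rewrite -[D]setTI; apply: measurable_fun_ltr => //; exact: measurable_funD.
have UV : indep P U V := increments_indep_next ndt (measurable_lindley (leqnn n)).
have -> : [set w | v < lindley n.+1 (increments X t w)]%R = [set w | D (U w, V w)].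
  by apply/seteqP; split => w; rewrite /D/= lt_max [X in _ || X]ltNge v0 orbF.
apply: le_trans (@probability_indep_le _ _ _ P U V D
  (fun y => (expR (- (th * v)))%:E * (expR (th * y))%:E) _ _ _ _ _ _ _) _ => //.
- apply: emeasurable_funM; first exact: measurable_cst.
  exact: measurable_expRM.
- move=> y; rewrite -EFinM -expRD.
  rewrite [X in P X](_ : _ = [set w | v - y < U w]%R); last first.
    by apply/seteqP; split => w; rewrite /D/= ltrBlDr.
  rewrite (_ : (- _ + _)%R = - (th * (v - y)))%R; last by ring.
  by apply: IH => i ni; apply: mgf1; exact: ltnW.
- rewrite ge0_integralZl//; last exact: measurable_expRM.
  rewrite -[leRHS]mule1 lee_pmul2l// ?lte_fin ?expR_gt0//.
  rewrite /V /increments integral_increment; last exact: ndt.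
  exact: mgf1.
Qed.

(** Given the last increment [y], Lundberg's bound at the level [Num.max u (u - y)] is at most
    [expR (- (th * u)) * expR (th' * y)]: for [y >= 0] because [th' >= 0], for [y < 0] because
    [th' <= th]. *)
Lemma lindley_end_tail n (t : nat -> R) (th th' u : R) : (0 <= th' <= th)%R -> nondecreasing_seq t ->
  (forall i, (i < n)%N -> mgf_net (t i.+1 - t i) th <= 1) ->
  P [set w | Num.max u (u - increments X t w n) <
             lindley n (increments X t w)]%R <=
  (expR (- (th * u)))%:E * mgf_net (t n.+1 - t n) th'.
Proof.
move=> /andP[th0 th'th] ndt mgf1.
set U := fun w => lindley n (increments X t w).
set V := fun w => increments X t w n.
have mU : measurable_fun setT U.
  apply: (measurableT_comp (measurable_lindley (leqnn n))).
  exact: measurable_increments.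
have mV : measurable_fun setT V by apply: measurable_funB; exact: measurable_net_input.
pose D := [set x : R * R | Num.max u (u - x.2) < x.1]%R.
have mD : measurable D.
  rewrite -[D]setTI; apply: measurable_fun_ltr => //; apply: measurable_maxr.
    exact: measurable_cst.
  by apply: measurable_funB => //; exact: measurable_cst.
have UV : indep P U V := increments_indep_next ndt (measurable_lindley (leqnn n)).
apply: le_trans (@probability_indep_le _ _ _ P U V D
  (fun y => (expR (- (th * u)))%:E * (expR (th' * y))%:E) _ _ _ _ _ _ _) _ => //.
- apply: emeasurable_funM; first exact: measurable_cst.
  exact: measurable_expRM.
- move=> y; rewrite -EFinM -expRD.
  have := lindley_tail (Num.max u (u - y))%R (le_trans th0 th'th) ndt mgf1.
  move=> /le_trans; apply.
  rewrite lee_fin ler_expR; have [y0|y0] := leP 0%R y.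
    by rewrite (max_idPl _) ?gerBl//; nra.
  have thy : (0 <= (th - th') * - y)%R.
    by rewrite mulr_ge0 ?subr_ge0// oppr_ge0 ltW.
  by rewrite (max_idPr _); nra.
- rewrite ge0_integralZl//; last exact: measurable_expRM.
  by rewrite /V /increments integral_increment//; exact: ndt.
Qed.

End MgfIncrements.

(** * Persistence on a grid *)

Section Persistence.
Context (d : measure_display) (Omega : measurableType d) (R : realType)
  (P : probability Omega R) (X : R -> {RV P >-> R}).
Hypothesis levyX : levy_process X.

Local Notation Y := (net_input X).

Definition stays (K : R) (n : nat) : set (nat -> R) :=
  [set z : (nat -> R) | forall i, (i <= n)%N -> (- K <= \sum_(j < i) z j)%R].

Lemma measurable_partial_sum n i : (i <= n)%N ->
  measurable_fun setT (fun z : seqspace R n => \sum_(j < i) z j)%R.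
Proof.
move=> ni; apply: measurable_sum => j.
by apply: measurable_coord; exact: leq_trans (ltn_ord j) ni.
Qed.

Lemma measurable_ge d' (T : measurableType d') (f : T -> R) (c : R) :
  measurable_fun setT f -> measurable [set x | c <= f x]%R.
Proof.
by move=> mf; rewrite -[[set _ | _]]setTI; apply: measurable_fun_ler.
Qed.

Lemma measurable_stays K n : measurable (stays K n : set (seqspace R n)).
Proof.
rewrite (_ : stays K n =
  \bigcap_(i < n.+1) [set z : (nat -> R) | - K <= \sum_(j < i) z j]%R); last first.
  by apply/seteqP; split => z Hz i /= ni; apply: Hz; rewrite ?ltnS// in ni *.
apply: bigcap_measurableType => i ni.
by apply: measurable_ge; apply: measurable_partial_sum; rewrite -ltnS.
Qed.

Lemma sum_increments t w i :
  (\sum_(j < i) increments X t w j = Y (t i) w - Y (t 0) w)%R.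
Proof.
elim: i => [|i IH]; first by rewrite big_ord0 subrr.
by rewrite big_ord_recr /= IH /increments; ring.
Qed.

Lemma measurable_grid_ge (t : nat -> R) K m :
  measurable [set w | forall i, (i <= m)%N -> (- K <= Y (t i) w)%R].
Proof.
rewrite (_ : [set _ | _] = \bigcap_(i < m.+1) [set w | - K <= Y (t i) w]%R).
  by apply: bigcap_measurableType => i ni; apply: measurable_ge; exact: measurable_net_input.
by apply/seteqP; split => z Hz i /= ni; apply: Hz; rewrite ?ltnS// in ni *.
Qed.

Lemma nondecreasing_grid (s h : R) : (0 <= h)%R ->
  nondecreasing_seq (fun i : nat => s + i%:R * h)%R.
Proof. by move=> h0 i j ij; rewrite lerD2l ler_wpM2r// ler_nat. Qed.

Lemma grid_stays K (h : R) m : 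
  [set w | forall i, (i <= m)%N -> (- K <= Y (i%:R * h)%R w)%R] =
  increments X (fun i : nat => 0 + i%:R * h)%R @^-1` (stays K m).
Proof.
apply/seteqP; split => w /= Hw i im; have := Hw i im.
  by rewrite sum_increments mul0r !add0r (net_input0 levyX) subr0.
by rewrite sum_increments mul0r !add0r (net_input0 levyX) subr0.
Qed.

(** A block that ends at or above its start lets the next one begin afresh: staying within [K] below
    the new origin implies staying above [- K]. The first block is peeled off rather than the last,
    so the induction needs no control of the final position. *)
Lemma persistence K (h : R) (r : nat) (p : \bar R) n : (0 <= K)%R -> (0 <= h)%R ->
  0 <= p ->
  p <= P [set w | (forall i, (i <= r)%N -> (- K <= Y (i%:R * h)%R w)%R) /\
                  (0 <= Y (r%:R * h)%R w)%R] ->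
  p ^+ n <= P [set w | forall i, (i <= n * r)%N -> (- K <= Y (i%:R * h)%R w)%R].
Proof.
move=> K0 h0 p0 pP; elim: n => [|n IH].
  rewrite mul0n expe0 (_ : [set _ | _] = setT) ?probability_setT//.
  apply/seteqP; split => // w _ i; rewrite leqn0 => /eqP ->.
  by rewrite mul0r (net_input0 levyX) oppr_le0.
rewrite expeS.
pose t (i : nat) : R := (0 + i%:R * h)%R.
pose t' (i : nat) : R := t (r + i)%N.
have ndt : nondecreasing_seq t by exact: nondecreasing_grid.
have ndt' : nondecreasing_seq t' by move=> i j ij; apply: ndt; rewrite leq_add2l.
pose E1 : set (seqspace R r) := stays K r `&` [set z : (nat -> R) | 0 <= \sum_(j < r) z j]%R.
pose E2 : set (seqspace R (n * r)) := stays K (n * r).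
have mE1 : measurable E1.
  apply: measurableI; first exact: measurable_stays.
  by apply: measurable_ge; exact: measurable_partial_sum.
have mE2 : measurable E2 by exact: measurable_stays.
have mU m s : measurable_fun setT (increments X s : Omega -> seqspace R m).
  exact: measurable_increments.
have PE1 : p <= P (increments X t @^-1` E1).
  apply: (le_trans pP); rewrite le_eqVlt; apply/orP; left; apply/eqP; congr (P _).
  apply/seteqP; split => w /=.
    move=> [H1 H2]; split => [i ir|/=]; rewrite sum_increments /t mul0r !add0r (net_input0 levyX) subr0//.
    exact: H1.
  move=> [H1 H2]; split => [i ir|/=].
    by have := H1 i ir; rewrite sum_increments /t mul0r !add0r (net_input0 levyX) subr0.
  by move: H2; rewrite /= sum_increments /t mul0r !add0r (net_input0 levyX) subr0.
have PE2 : p ^+ n <= P (increments X t' @^-1` E2).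
  rewrite grid_stays in IH.
  rewrite (increments_law levyX ndt' ndt _ mE2)//.
  by move=> i _; rewrite /t' /t -!natr1 !natrD -natr1; ring.
have E12 : P (increments X t @^-1` E1 `&` increments X t' @^-1` E2) =
           P (increments X t @^-1` E1) * P (increments X t' @^-1` E2).
  exact: (increments_indep levyX ndt mE1 mE2).
apply: (@le_trans _ _ (P (increments X t @^-1` E1) * P (increments X t' @^-1` E2))).
  by apply: lee_pmul => //; rewrite expe_ge0.
rewrite -E12; apply: le_measure; rewrite ?inE.
- apply: measurableI.
    exact: (measurable_preimage (mU r t) mE1).
  exact: (measurable_preimage (mU (n * r)%N t') mE2).
- exact: (measurable_grid_ge (fun i => i%:R * h)%R).
move=> w [[H1 H2] H3] i inr /=.
have [ir|ir] := leqP i r.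
  by have := H1 i ir; rewrite sum_increments /t mul0r !add0r (net_input0 levyX) subr0.
have ir' : (i - r <= n * r)%N by rewrite leq_subLR -mulSn.
have := H3 _ ir'; rewrite sum_increments /t' /t addn0 !add0r subnKC ?(ltnW ir)//.
move: H2; rewrite /= sum_increments /t mul0r !add0r (net_input0 levyX) subr0.
lra.
Qed.

(** [- Y (- a)] is the increment over [[- a, 0]]: independent of the increments after time 0, and
    distributed like [Y a]. *)
Lemma start_persistence (a c h K : R) m : (0 <= a)%R -> (0 <= h)%R ->
  P [set w | (c <= - Y (- a)%R w)%R /\
             forall i, (i <= m)%N -> (- K <= Y (i%:R * h)%R w)%R] =
  P [set w | c <= Y a w]%R *
  P [set w | forall i, (i <= m)%N -> (- K <= Y (i%:R * h)%R w)%R].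
Proof.
move=> a0 h0.
pose t (i : nat) : R := if i is j.+1 then (0 + j%:R * h)%R else (- a)%R.
have ndt : nondecreasing_seq t.
  apply/nondecreasing_seqP => -[|i]/=; first by rewrite mul0r addr0 oppr_le0.
  by apply: (nondecreasing_grid 0 h0).
pose E1 : set (seqspace R 1) := [set z : (nat -> R) | c <= z 0%N]%R.
pose E2 : set (seqspace R m) := stays K m.
have mE1 : measurable E1 by apply: measurable_ge; exact: measurable_coord.
have mE2 : measurable E2 by exact: measurable_stays.
have E2E : increments X (fun i => t (1 + i)%N) @^-1` E2 =
  [set w | forall i, (i <= m)%N -> (- K <= Y (i%:R * h)%R w)%R].
  by rewrite grid_stays.
have E1E : increments X t @^-1` E1 = [set w | c <= - Y (- a)%R w]%R.
  by apply/seteqP; split => w; rewrite /E1/= /increments /t mul0r addr0 (net_input0 levyX) sub0r.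
have := increments_indep levyX ndt mE1 mE2.
rewrite E2E => E12; transitivity (P (increments X t @^-1` E1 `&`
   [set w | forall i, (i <= m)%N -> (- K <= Y (i%:R * h)%R w)%R])).
  by rewrite E1E.
rewrite E12 E1E; congr (_ * _).
have mc : measurable [set x : R | c <= x]%R by exact: measurable_ge.
have := increments_stationary levyX (- a) 0 a0 mc; rewrite addNr add0r => H.
transitivity (P [set w | [set x : R | c <= x]%R (Y 0 w - Y (- a)%R w)%R]).
  by congr (P _); apply/seteqP; split => w; rewrite /= (net_input0 levyX) sub0r.
by rewrite H; congr (P _); apply/seteqP; split => w; rewrite /= (net_input0 levyX) subr0.
Qed.

End Persistence.

(** * Cramer's lower bound *)

Section MgfCalculus.
Context (R : realType) (L : R -> R) (b : R).
Local Open Scope ring_scope.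

Hypothesis L_conv : forall x y t : R, 0 <= x <= b -> 0 <= y <= b ->
  0 <= t <= 1 -> L ((1 - t) * x + t * y) <= (1 - t) * L x + t * L y.
Hypothesis L_halving : forall x h : R, 0 <= h -> 0 <= x - h -> x + h <= b ->
  4 * (L (x + h / 2) + L (x - h / 2) - 2 * L x) <= L (x + h) + L (x - h) - 2 * L x.

(** Along the steps [h0 / 2 ^+ k] the second difference is at most [D0 / 4 ^+ k], so its ratio to
    the step is of order [1 / 2 ^+ k]. *)
Lemma second_difference_small (x h0 e : R) :
  0 < h0 -> 0 <= x - h0 -> x + h0 <= b -> 0 < e ->
  exists2 h, 0 < h <= h0 & L (x + h) + L (x - h) - 2 * L x <= e * h.
Proof.
move=> h00 xh0 xhb e0; set D0 := L (x + h0) + L (x - h0) - 2 * L x.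
have two0 k : (0 : R) < 2 ^+ k by rewrite exprn_gt0.
have H k : L (x + h0 / 2 ^+ k) + L (x - h0 / 2 ^+ k) - 2 * L x <= D0 / 4 ^+ k.
  elim: k => [|k IH]; first by rewrite !expr0 !divr1.
  have hk0 : 0 <= h0 / 2 ^+ k by rewrite divr_ge0 ?ltW.
  have hk1 : h0 / 2 ^+ k <= h0.
    by rewrite ler_pdivrMr// ler_peMr ?(ltW h00)// exprn_ege1// ler1n.
  have xk0 : 0 <= x - h0 / 2 ^+ k by lra.
  have xkb : x + h0 / 2 ^+ k <= b by lra.
  have := L_halving hk0 xk0 xkb.
  have -> : h0 / 2 ^+ k / 2 = h0 / 2 ^+ k.+1 by rewrite exprSr invfM mulrA.
  have -> : D0 / 4 ^+ k.+1 = D0 / 4 ^+ k / 4 by rewrite exprSr invfM mulrA.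
  by move: IH; lra.
have [k kP] : exists k : nat, `|D0| / (e * h0) < 2 ^+ k.
  exists (Num.trunc (`|D0| / (e * h0))).+1.
  apply: (lt_trans (truncnS_gt _)).
  by rewrite -natrX ltr_nat ltn_expl.
exists (h0 / 2 ^+ k).
  by rewrite divr_gt0//= ler_pdivrMr// ler_peMr ?(ltW h00)// exprn_ege1// ler1n.
apply: (le_trans (H k)); apply: (@le_trans _ _ (`|D0| / 4 ^+ k)).
  by rewrite ler_wpM2r ?ler_norm// invr_ge0 exprn_ge0.
have -> : `|D0| / 4 ^+ k = `|D0| / 2 ^+ k / 2 ^+ k.
  by rewrite -mulrA -invfM -exprMn; congr (_ / _ ^+ _); ring.
rewrite [leRHS]mulrA ler_pM2r ?invr_gt0//.
by rewrite ler_pdivrMr// mulrC -ler_pdivrMr ?mulr_gt0// ltW.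
Qed.

Lemma midpoint_convex (x h : R) : 0 <= h -> 0 <= x - h -> x + h <= b ->
  2 * L x <= L (x + h) + L (x - h).
Proof.
move=> h0 xh0 xhb.
have := @L_conv (x - h) (x + h) 2^-1.
have -> : (1 - 2^-1) * (x - h) + 2^-1 * (x + h) = x by field.
have I1 : 0 <= x - h <= b by apply/andP; split; lra.
have I2 : 0 <= x + h <= b by apply/andP; split; lra.
have I3 : 0 <= (2^-1 : R) <= 1 by lra.
by move=> /(_ I1 I2 I3); lra.
Qed.

(** Chords from [x] to [x - h0] and [x + h0] bound [L] from above; midpoint convexity turns the
    upper bound at [x - h] into a lower bound at [x + h]. Hence a local Lipschitz estimate at
    [x]. *)
Lemma continuous_convex (x : R) : 0 < x -> x < b -> {for x, continuous L}.
Proof.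
move=> x0 xb.
pose h0 := Num.min x (b - x).
have h00 : 0 < h0 by rewrite lt_min x0 subr_gt0.
have h0x : h0 <= x by rewrite ge_min lexx.
have h0b : h0 <= b - x by rewrite ge_min lexx orbT.
(* [C] dominates both chord slopes; the [+ 1] makes it positive, for the division [e / C]. *)
pose C := (`|L (x + h0) - L x| + `|L (x - h0) - L x|) / h0 + 1.
have C0 : 0 < C by rewrite ltr_wpDl// divr_ge0 ?addr_ge0// ltW.
have step (s h : R) : (s = h0 \/ s = - h0) -> 0 <= h <= h0 ->
    L (x + h / h0 * s) - L x <= C * h.
  move=> sE /andP[h_ge0 hh0].
  have t01 : 0 <= (h / h0 : R) <= 1.
    apply/andP; split; first by rewrite divr_ge0// ltW.
    by rewrite ler_pdivrMr// mul1r.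
  have I1 : 0 <= x <= b by apply/andP; split; lra.
  have I2 : 0 <= x + s <= b by case: sE => ->; apply/andP; split; lra.
  have := L_conv I1 I2 t01.
  have -> : (1 - h / h0) * x + h / h0 * (x + s) = x + h / h0 * s by ring.
  move=> H; apply: (@le_trans _ _ (h / h0 * (L (x + s) - L x))); first by lra.
  apply: (@le_trans _ _ (h / h0 * `|L (x + s) - L x|)).
    by rewrite ler_wpM2l ?ler_norm//; case/andP: t01.
  set A := `|L (x + h0) - L x|; set B := `|L (x - h0) - L x|.
  have -> : C * h = h / h0 * (A + B) + h by rewrite /C -/A -/B; ring.
  rewrite ler_wpDr// ler_wpM2l//; first by case/andP: t01.
  by case: sE => ->; rewrite -/A -/B ?lerDl ?lerDr normr_ge0.
have lip (h : R) : `|h| <= h0 -> `|L x - L (x + h)| <= C * `|h|.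
  move=> hh0; have nh : 0 <= `|h| <= h0 by rewrite normr_ge0.
  have up (s : R) : `|s| <= h0 -> L (x + s) - L x <= C * `|s|.
    move=> sh0; have ns : 0 <= `|s| <= h0 by rewrite normr_ge0.
    have [s0|s0] := leP 0 s.
      have := step h0 _ (or_introl erefl) ns.
      by rewrite ger0_norm// divfK// gt_eqF.
    have := step (- h0) _ (or_intror erefl) ns.
    by rewrite ltr0_norm// mulrN divfK ?gt_eqF// opprK.
  have h_up := up h hh0.
  have h_dn := up (- h); rewrite normrN in h_dn.
  have {}h_dn := h_dn hh0.
  have mid : 2 * L x <= L (x + h) + L (x - h).
    have [hp|hn] := leP 0 h.
      by move: hh0; rewrite ger0_norm// => ?; apply: midpoint_convex => //; lra.
    move: hh0; rewrite ltr0_norm// => ?.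
    have := @midpoint_convex x (- h); rewrite opprK => M.
    by rewrite addrC; apply: M; lra.
  by rewrite ler_norml; apply/andP; split; lra.
pose e1 e := Num.min h0 (e / C).
apply/cvgrPdist_le => e e0; near=> y.
have yx : `|x - y| < e1 e.
  near: y.
  have e10 : 0 < e1 e by rewrite lt_min h00 divr_gt0.
  by have := nbhsx_ballx x (e1 e) e10; rewrite -ball_normE.
have [yx1 yx2] : `|y - x| < h0 /\ `|y - x| < e / C.
  by move: yx; rewrite distrC lt_min => /andP.
rewrite -(subrKC x y); apply: (le_trans (lip _ (ltW yx1))).
by rewrite mulrC -ler_pdivlMr// ltW.
Unshelve. all: by end_near. Qed.


(** [al] and [be] enclose the slope of [L] at [th], which is the drift of the walk tilted there.
    Their ratio has to be close to 1, since reaching level [u] takes about [u / al] steps, each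
    charged [th * be] in the exponent. *)
Lemma slopes_at_level (th e : R) : 0 < th < b -> 0 < e ->
  L 0 = 1 -> L th = 1 -> L (th / 2) < 1 ->
  exists al be h, 
    [/\ 0 < al, be <= (1 + e) * al & L (th - h) < 1 - h * al] /\
    [/\ 0 < h, 0 <= th - h, th + h <= b & L (th + h) < 1 + h * be].
Proof.
move=> /andP[th0 thb] e0 L0 Lth Lh.
pose l0 := (1 - L (th / 2)) / (th / 2).
have l00 : 0 < l0 by rewrite divr_gt0 ?subr_gt0//; lra.
(* The inequality [l + 2 * dl <= (1 + e) * (l - dl)] amounts to [(3 + e) * dl <= e * l], which this
   choice ensures for every slope [l >= l0]. *)
pose dl := e * l0 / (3 + e).
have e3 : 0 < 3 + e by lra.
have dl0 : 0 < dl by rewrite divr_gt0// mulr_gt0.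
have dlE : (3 + e) * dl = e * l0 by rewrite /dl; field; lra.
have dll : dl < l0.
  rewrite /dl ltr_pdivrMr// mulrC ltr_pM2l//; lra.
pose h0 := Num.min (th / 2) (b - th).
have h00 : 0 < h0 by rewrite lt_min subr_gt0 thb divr_gt0.
have h0x : h0 <= th / 2 by rewrite ge_min lexx.
have h0b : h0 <= b - th by rewrite ge_min lexx orbT.
have [||h /andP[hp hh0] H] := @second_difference_small th h0 dl h00 _ _ dl0; try lra.
pose l := (1 - L (th - h)) / h.
have lE : L (th - h) = 1 - h * l by rewrite /l; field; lra.
(* By convexity the difference quotient just left of [th] is at least the slope [l0] of the longer
   chord from [th / 2]. *)
have l0l : l0 <= l.
  have t01 : 0 <= (h / (th / 2) : R) <= 1.
    apply/andP; split; first by rewrite divr_ge0 ?divr_ge0// ltW.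
    by rewrite ler_pdivrMr ?mul1r ?divr_gt0//; lra.
  have I1 : 0 <= th <= b by lra.
  have I2 : 0 <= th / 2 <= b by lra.
  have := L_conv I1 I2 t01; rewrite Lth.
  have -> : (1 - h / (th / 2)) * th + h / (th / 2) * (th / 2) = th - h by field; lra.
  move=> Hc; rewrite /l ler_pdivlMr//.
  have -> : l0 * h = h / (th / 2) * (1 - L (th / 2)) by rewrite /l0; ring.
  lra.
have hl : 0 < h * dl by rewrite mulr_gt0.
exists (l - dl), (l + 2 * dl), h; split; split => //.
- lra.
- have : e * l0 <= e * l by rewrite ler_pM2l.
  nra.
- rewrite lE; lra.
- lra.
- lra.
- move: H; rewrite lE Lth; lra.
Qed.

(** At a minimiser of [L] the tilted drift vanishes, so [L x - e1 * x] is minimised instead: there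
    [L] has slope about [e1], small but positive, and the tilted walk still drifts upwards. *)
Lemma slopes_near_min (th e : R) : 0 < th < b -> 0 < e ->
  L th = 1 -> L (th / 2) < 1 -> (forall x, 0 <= x <= b -> expR (- x) <= L x) ->
  exists x be h, 
    [/\ 0 < x < th, be < e & L (x - h) < L x] /\
    [/\ 0 < h, 0 <= x - h, x + h <= b & L (x + h) < L x * (1 + h * be)].
Proof.
move=> /andP[th0 thb] e0 Lth Lh Lexp.
pose gap := 1 - L (th / 2).
have gap0 : 0 < gap by rewrite subr_gt0.
(* The first term excludes [th] as the minimiser of [g]; the second gives [2 * e1 / L c < e], since
   [L c >= expR (- th)]. *)
pose e1 := Num.min (gap / th) (e * expR (- th) / 4).
have e10 : 0 < e1 by rewrite lt_min !divr_gt0// mulr_gt0// expR_gt0.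
have e1g : e1 * th <= gap by rewrite -ler_pdivlMr// ge_min lexx.
have e1e : e1 <= e * expR (- th) / 4 by rewrite ge_min lexx orbT.
(* The interval is cut at [tha > 0] because [continuous_convex] covers interior points only;
   [tha <= gap / 2] excludes [tha] as the minimiser, by [L tha >= 1 - tha]. *)
pose tha := Num.min (gap / 2) (th / 4).
have tha0 : 0 < tha by rewrite lt_min !divr_gt0.
have thag : tha <= gap / 2 by rewrite ge_min lexx.
have thath : tha <= th / 4 by rewrite ge_min lexx orbT.
pose g x := L x - e1 * x.
have cg : {within `[tha, th], continuous g}.
  apply: continuous_in_subspaceT => x /[!inE]/=; rewrite in_itv/= => /andP[x1 x2].
  apply: cvgB; first by apply: continuous_convex; lra.
  by apply: cvgM; [exact: cvg_cst|exact: cvg_id].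
have thath' : tha <= th by lra.
have [c cI cmin] := EVT_min thath' cg.
have cth2 : g c <= g (th / 2) by apply: cmin; rewrite in_itv/=; lra.
have ca : c != tha.
  apply/eqP => cE; move: cth2; rewrite cE /g.
  have I : 0 <= tha <= b by lra.
  have := Lexp _ I; have := expR_ge1Dx (- tha); rewrite /gap in thag gap0 *.
  have : 0 < e1 * (th / 2 - tha) by rewrite mulr_gt0//; lra.
  lra.
have cb : c != th.
  apply/eqP => cE; move: cth2; rewrite cE /g Lth.
  have : 0 < e1 * th by rewrite mulr_gt0.
  rewrite /gap in e1g; lra.
move: cI; rewrite in_itv/= => /andP[ac cth].
have {ca}ac : tha < c by rewrite lt_neqAle eq_sym ca.
have {cb}cth : c < th by rewrite lt_neqAle cb.
pose h0 := Num.min (c - tha) (th - c).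
have h00 : 0 < h0 by rewrite lt_min !subr_gt0 ac.
have h0x : h0 <= c - tha by rewrite ge_min lexx.
have h0b : h0 <= th - c by rewrite ge_min lexx orbT.
have e12 : 0 < e1 / 2 by rewrite divr_gt0.
have [||h /andP[hp hh0] H] := @second_difference_small c h0 (e1 / 2) h00 _ _ e12; try lra.
have g1 : g c <= g (c - h) by apply: cmin; rewrite in_itv/=; lra.
have g2 : g c <= g (c + h) by apply: cmin; rewrite in_itv/=; lra.
have e1h : 0 < e1 * h by rewrite mulr_gt0.
have Lc : expR (- th) <= L c.
  have I : 0 <= c <= b by lra.
  by apply: le_trans (Lexp _ I); rewrite ler_expR; lra.
have Lc0 : 0 < L c by apply: lt_le_trans Lc; exact: expR_gt0.
exists c, (2 * e1 / L c), h; split; split => //.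
- lra.
- rewrite ltr_pdivrMr//.
  have : e * expR (- th) <= e * L c by rewrite ler_pM2l.
  have : 0 < e * expR (- th) by rewrite mulr_gt0// expR_gt0.
  lra.
- rewrite /g in g1 g2; lra.
- lra.
- lra.
- have -> : L c * (1 + h * (2 * e1 / L c)) = L c + 2 * (e1 * h) by field; lra.
  rewrite /g in g1 g2; lra.
Qed.

End MgfCalculus.

Lemma expR_tangent (R : realType) (a m : R) :
  (expR m * (1 + (a - m)) <= expR a)%R.
Proof.
rewrite -{2}(subrKC m a) expRD ler_pM2l ?expR_gt0//; exact: expR_ge1Dx.
Qed.

(** * Moment generating functions: convexity and the halving inequality *)

Section Mgf.
Context (d : measure_display) (Omega : measurableType d) (R : realType)
  (P : probability Omega R).
Variables (Z : Omega -> R) (b : R).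
Hypotheses (mZ : measurable_fun setT Z)
  (Zb : \int[P]_w (expR (b * Z w))%:E < +oo).

Definition mgf (x : R) : R := fine (\int[P]_w (expR (x * Z w))%:E).

Lemma mgfE (x : R) : (0 <= x <= b)%R ->
  \int[P]_w (expR (x * Z w))%:E = (mgf x)%:E.
Proof.
move=> /andP[x0 xb]; rewrite /mgf fineK// ge0_fin_numE; last first.
  by apply: integral_ge0 => w _; rewrite lee_fin expR_ge0.
apply: (@le_lt_trans _ _ (\int[P]_w (1 + (expR (b * Z w))%:E))).
  apply: ge0_le_integral => //.
  - exact: measurable_expRM.
  - by apply: emeasurable_funD => //; exact: measurable_expRM.
  - move=> w _; rewrite lee_fin; have [Z0|Z0] := leP 0%R (Z w).
      by rewrite ler_wpDl// ler_expR ler_wpM2r.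
    by rewrite ler_wpDr ?expR_ge0// -[leRHS]expR0 ler_expR mulr_ge0_le0// ltW.
rewrite ge0_integralD//; last exact: measurable_expRM.
by rewrite integral_cst//= mul1e probability_setT lte_add_pinfty// ltry.
Qed.

(** Each pair is a coefficient and an exponent. An inequality between two such exponential sums,
    valid at every [z], passes to [mgf]; keeping the coefficients nonnegative on both sides avoids
    subtracting integrals. *)
Definition lin_comb (s : seq (R * R)) (f : R -> R) : R :=
  (\sum_(p <- s) p.1 * f p.2)%R.

Lemma lin_comb_cons2 p q s f :
  lin_comb (p :: q :: s) f = (p.1 * f p.2 + lin_comb (q :: s) f)%R.
Proof. by rewrite /lin_comb big_cons. Qed.

Lemma lin_comb1 p f : lin_comb [:: p] f = (p.1 * f p.2)%R.
Proof. by rewrite /lin_comb big_seq1. Qed.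

Definition admissible (s : seq (R * R)) : bool :=
  all (fun p => (0 <= p.1) && (0 <= p.2 <= b))%R s.

Lemma measurable_lin_comb s :
  measurable_fun setT (fun w => (lin_comb s (fun x => expR (x * Z w)))%:E).
Proof.
apply/measurable_EFinP; apply: measurable_sum => p.
apply: measurable_funM; first exact: measurable_cst.
by apply/measurable_EFinP; exact: measurable_expRM.
Qed.

Lemma lin_comb_ge0 s f : admissible s -> (forall x, 0 <= f x)%R ->
  (0 <= lin_comb s f)%R.
Proof.
move=> /allP sP f0; rewrite /lin_comb big_seq; apply: sumr_ge0 => p /sP.
by move=> /andP[p0 _]; rewrite mulr_ge0.
Qed.

Lemma integral_lin_comb s : admissible s ->
  \int[P]_w (lin_comb s (fun x => expR (x * Z w)))%:E = (lin_comb s mgf)%:E.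
Proof.
elim: s => [_|[c x] s IH /= /andP[/= /andP[c0 xI] sP]].
  rewrite /lin_comb big_nil.
  by under eq_integral do rewrite big_nil; rewrite integral0.
rewrite /lin_comb big_cons /= EFinD EFinM -mgfE// -/(lin_comb s mgf) -IH//.
rewrite -ge0_integralZl//; last exact: measurable_expRM.
rewrite -ge0_integralD//; last 4 first.
- by move=> w _; rewrite -EFinM lee_fin mulr_ge0// expR_ge0.
- by apply: emeasurable_funM; [exact: measurable_cst|exact: measurable_expRM].
- by move=> w _; rewrite lee_fin; apply: lin_comb_ge0 => // y; exact: expR_ge0.
- exact: measurable_lin_comb.
by apply: eq_integral => w _; rewrite big_cons.
Qed.

Lemma mgf_lin_comb_le s1 s2 : admissible s1 -> admissible s2 ->
  (forall z, lin_comb s1 (fun x => expR (x * z)) <=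
             lin_comb s2 (fun x => expR (x * z)))%R ->
  (lin_comb s1 mgf <= lin_comb s2 mgf)%R.
Proof.
move=> s1P s2P s12; rewrite -lee_fin -!integral_lin_comb//.
apply: ge0_le_integral => //.
- by move=> w _; rewrite lee_fin; apply: lin_comb_ge0 => // y; exact: expR_ge0.
- exact: measurable_lin_comb.
- exact: measurable_lin_comb.
- by move=> w _; rewrite lee_fin.
Qed.

Lemma mgf0 : mgf 0 = 1%R.
Proof.
rewrite /mgf; under eq_integral do rewrite mul0r expR0.
by rewrite integral_cst//= mul1e probability_setT.
Qed.

Lemma mgf_convex (x y t : R) : (0 <= x <= b)%R -> (0 <= y <= b)%R ->
  (0 <= t <= 1)%R ->
  (mgf ((1 - t) * x + t * y) <= (1 - t) * mgf x + t * mgf y)%R.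
Proof.
move=> xI yI tI.
have := @mgf_lin_comb_le [:: (1, (1 - t) * x + t * y)]%R [:: (1 - t, x); (t, y)]%R.
rewrite !lin_comb_cons2 !lin_comb1 /= mul1r; apply.
- by rewrite /admissible /= andbT; apply/andP; split => //; nra.
- by rewrite /admissible /= xI yI; lra.
move=> z; rewrite !lin_comb_cons2 !lin_comb1 /= mul1r.
have [t0 t1] := andP tI.
set m := (((1 - t) * x + t * y) * z)%R.
have := expR_tangent (x * z) m; have := expR_tangent (y * z) m.
move=> /(ler_wpM2l t0) Hy Hx.
have t1' : (0 <= 1 - t)%R by rewrite subr_ge0.
have {Hx} := lerD (ler_wpM2l t1' Hx) Hy.
rewrite [X in (X <= _)%R -> _](_ : _ = expR m)//.
have mE : m = ((1 - t) * (x * z) + t * (y * z))%R by rewrite /m; ring.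
have -> : ((1 - t) * (expR m * (1 + (x * z - m))) + t * (expR m * (1 + (y * z - m))) =
  expR m * (1 + ((1 - t) * (x * z) + t * (y * z) - m)))%R by ring.
by rewrite -mE subrr addr0 mulr1.
Qed.

(** Put [s = expR (h / 2 * z)]. Once the negative terms have changed sides, the difference of the
    integrands is [expR (x * z) * (s + s^-1 - 2) ^+ 2]. *)
Lemma mgf_halving (x h : R) : (0 <= h)%R -> (0 <= x - h)%R -> (x + h <= b)%R ->
  (4 * (mgf (x + h / 2) + mgf (x - h / 2) - 2 * mgf x) <=
   mgf (x + h) + mgf (x - h) - 2 * mgf x)%R.
Proof.
move=> h0 xh0 xhb.
have := @mgf_lin_comb_le [:: (4, x + h / 2); (4, x - h / 2)]%R
  [:: (1, x + h); (1, x - h); (6, x)]%R.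
rewrite !lin_comb_cons2 !lin_comb1 /= !mul1r.
move: (mgf (x + h / 2)) (mgf (x - h / 2)) (mgf (x + h)) (mgf (x - h)) (mgf x).
move=> m1 m2 m3 m4 m5 H; suff : (4 * m1 + 4 * m2 <= m3 + (m4 + 6 * m5))%R by lra.
apply: H.
- by rewrite /admissible /=; lra.
- by rewrite /admissible /=; lra.
move=> z; rewrite !lin_comb_cons2 !lin_comb1 /= !mul1r.
pose s := expR (h / 2 * z).
pose s' := expR (- (h / 2 * z)).
have ss' : (s * s' = 1)%R by rewrite /s /s' expRN divff// gt_eqF// expR_gt0.
have -> : (expR ((x + h / 2) * z) = expR (x * z) * s)%R.
  by rewrite /s -expRD; congr expR; ring.
have -> : (expR ((x - h / 2) * z) = expR (x * z) * s')%R.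
  by rewrite /s' -expRD; congr expR; ring.
have -> : (expR ((x + h) * z) = expR (x * z) * (s * s))%R.
  by rewrite /s -!expRD; congr expR; field.
have -> : (expR ((x - h) * z) = expR (x * z) * (s' * s'))%R.
  by rewrite /s' -!expRD; congr expR; field.
set e := expR (x * z).
have e0 : (0 <= e)%R by exact: expR_ge0.
have : (0 <= e * ((s + s' - 2) * (s + s' - 2)))%R by rewrite mulr_ge0// -expr2 sqr_ge0.
have -> : (e * ((s + s' - 2) * (s + s' - 2)) =
  e * (s * s) + e * (s' * s') + 2 * e * (s * s') + 4 * e - 4 * e * s - 4 * e * s')%R by ring.
rewrite ss'; lra.
Qed.

End Mgf.

(** A quarter is the share allowed to each of the two tails of the tilted law, which leaves half of
    the mass. *)
Lemma expr_ratio_small (R : realType) (q l : R) : (0 <= q)%R -> (q < l)%R ->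
  exists N0 : nat, forall N : nat, (N0 <= N)%N -> (q ^+ N <= l ^+ N / 4)%R.
Proof.
move=> q0 ql; have l0 : (0 < l)%R by exact: le_lt_trans ql.
have r0 : (0 <= q / l)%R by rewrite divr_ge0// ltW.
have r1 : (`|q / l| < 1)%R by rewrite ger0_norm// ltr_pdivrMr// mul1r.
have /cvgrPdist_lt/(_ (4^-1 : R)%R) := cvg_expr r1.
case; first by rewrite invr_gt0.
move=> N0 _ HN; exists N0 => N N0N; have := HN N N0N => /=.
rewrite sub0r normrN ger0_norm ?exprn_ge0// => /ltW.
by rewrite expr_div_n ler_pdivrMr ?exprn_gt0// mulrC.
Qed.

(** * Exponential moments of a centred Levy process and exponential tilting *)

Section LevyMgf.
Context (d : measure_display) (Omega : measurableType d) (R : realType)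
  (P : probability Omega R) (X : R -> {RV P >-> R}).
Hypothesis levyX : levy_process X.

Local Notation Y := (net_input X).
Local Notation L := (mgf P (Y 1)).

Lemma mmt_gen_funE (U : {RV P >-> R}) th :
  'M_P U th = \int[P]_w (expR (th * U w))%:E.
Proof.
rewrite /mmt_gen_fun unlock; apply: eq_integral => w _ /=.
by rewrite mulrC.
Qed.

Lemma mgf_net1E th : mgf_net X 1 th = (expR (- th))%:E * 'M_P (X 1%R) th.
Proof.
rewrite mmt_gen_funE /mgf_net -ge0_integralZl//; last exact: measurable_expRM.
apply: eq_integral => w _; rewrite -EFinM -expRD; congr (expR _)%:E.
by rewrite /net_input; ring.
Qed.

(** Integrate [1 + th * x <= expR (th * x)]. As the exponential may fail to be integrable, the
    negative part of [X 1] is first moved to its side. *)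
Lemma mmt_gen_fun_ge1 th : 'E_P[X 1%R] = 0 -> (0 <= th)%R -> 1 <= 'M_P (X 1%R) th.
Proof.
move=> EX0 th0.
pose f w := (X 1%R w)%:E.
have mf : measurable_fun setT f by apply/measurable_EFinP.
pose a := \int[P]_w f^\+ w.
pose b := \int[P]_w f^\- w.
have a0 : 0 <= a by apply: integral_ge0.
have b0 : 0 <= b by apply: integral_ge0.
have ab : a - b = 0 by rewrite -integralE -EX0 unlock.
(* [+oo - +oo] is [-oo], so a null expectation forces both parts to be finite and equal. *)
have [abE afin] : a = b /\ a \is a fin_num.
  move: a b a0 b0 ab => [a| |] [b| |]//= _ _.
  by rewrite -EFinB => -[/eqP]; rewrite subr_eq0 => /eqP ->.
have mp : measurable_fun setT f^\+ by exact: measurable_funepos.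
have mn : measurable_fun setT f^\- by exact: measurable_funeneg.
pose e w := (expR (th * X 1%R w))%:E.
have me : measurable_fun setT e by exact: measurable_expRM.
have thE : 0 <= th%:E by rewrite lee_fin.
have Me : 'M_P (X 1%R) th = \int[P]_w e w by exact: mmt_gen_funE.
have H : \int[P]_w (1 + th%:E * f^\+ w) <= \int[P]_w (e w + th%:E * f^\- w).
  apply: ge0_le_integral => //.
  - by move=> w _; rewrite adde_ge0 ?mule_ge0 ?funepos_ge0.
  - apply: emeasurable_funD; first exact: measurable_cst.
    by apply: emeasurable_funM => //; exact: measurable_cst.
  - apply: emeasurable_funD => //.
    by apply: emeasurable_funM => //; exact: measurable_cst.
  - move=> w _; rewrite funeposE funenegE /f /e -EFinN -!EFin_max -!EFinM -!EFinD lee_fin.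
    have := expR_ge1Dx (th * X 1%R w).
    have [x0|x0] := leP 0%R (X 1%R w).
      by rewrite (max_idPr _) ?oppr_le0// mulr0; lra.
    have -> : Num.max (- X 1%R w)%R 0%R = (- X 1%R w)%R by apply/max_idPl; rewrite oppr_ge0 ltW.
    lra.
move: H; rewrite ge0_integralD//; last 2 first.
- by move=> w _; rewrite mule_ge0 ?funepos_ge0.
- by apply: emeasurable_funM => //; exact: measurable_cst.
rewrite ge0_integralD//; last 3 first.
- by move=> w _; rewrite lee_fin expR_ge0.
- by move=> w _; rewrite mule_ge0 ?funeneg_ge0.
- by apply: emeasurable_funM => //; exact: measurable_cst.
rewrite !ge0_integralZl//.
rewrite -Me -/a -/b -abE integral_cst//= mul1e.
by rewrite probability_setT leeD2rE// fin_numM.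
Qed.


Lemma mgf_net_ge_expRN th : 'E_P[X 1%R] = 0 -> (0 <= th)%R ->
  (expR (- th))%:E <= mgf_net X 1 th.
Proof.
move=> EX0 th0; rewrite mgf_net1E -[leLHS]mule1.
by rewrite lee_pmul2l// ?lte_fin ?expR_gt0//; exact: mmt_gen_fun_ge1.
Qed.

Section FiniteMgf.
Variable b : R.
Hypotheses (EX0 : 'E_P[X 1%R] = 0)
  (Mb : mgf_net X 1 b < +oo).

Let mY : measurable_fun setT (Y 1) := measurable_net_input X 1.

Lemma mgf_ge_expRN x : (0 <= x <= b)%R -> (expR (- x) <= L x)%R.
Proof.
move=> /[dup] xI /andP[x0 _]; rewrite -lee_fin -(mgfE mY Mb xI).
exact: mgf_net_ge_expRN.
Qed.

Lemma mgf_gt0 x : (0 <= x <= b)%R -> (0 < L x)%R.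
Proof. by move=> /mgf_ge_expRN; apply: lt_le_trans; exact: expR_gt0. Qed.

(** Otherwise [1 - expR (th / 2 * Y 1)] has second moment [1 - 2 * L (th / 2) + L th <= 0]. Then
    [Y 1 = 0], hence [X 1 = 1], almost surely, against the null expectation. *)
Lemma mgf_half_lt1 th : (0 < th <= b)%R -> L th = 1%R -> (L (th / 2) < 1)%R.
Proof.
move=> /andP[th0 thb] Lth; rewrite ltNge; apply/negP => Lh.
pose s w := expR (th / 2 * Y 1 w).
pose f w := ((1 - s w) * (1 - s w))%:E.
have mes : measurable_fun setT (fun w => (s w)%:E) by exact: measurable_expRM.
have ms : measurable_fun setT s by exact/measurable_EFinP.
have f0 w : 0 <= f w by rewrite lee_fin -expr2 sqr_ge0.
have mf : measurable_fun setT f.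
  apply/measurable_EFinP; apply: measurable_funM;
    by apply: measurable_funB => //; exact: measurable_cst.
have I1 : (0 <= th / 2 <= b)%R by lra.
have I2 : (0 <= th <= b)%R by lra.
have If : \int[P]_w f w = 0.
  have E : \int[P]_w f w + 2%:E * (L (th / 2))%:E = 2%:E.
    rewrite -(mgfE mY Mb I1) -ge0_integralZl//.
    rewrite -ge0_integralD//; last first.
      by apply: emeasurable_funM => //; exact: measurable_cst.
    transitivity (\int[P]_w (1 + (expR (th * Y 1 w))%:E)).
      apply: eq_integral => w _; rewrite /f -EFinM -!EFinD; congr EFin.
      have -> : expR (th * Y 1 w) = (s w * s w)%R.
        by rewrite /s -expRD; congr expR; field.
      by rewrite /s; ring.
    rewrite ge0_integralD//; last exact: measurable_expRM.
    rewrite (mgfE mY Mb I2) Lth integral_cst//= mul1e probability_setT.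
    by rewrite -EFinD; congr EFin; ring.
  have If0 : 0 <= \int[P]_w f w by apply: integral_ge0 => w _; exact: f0.
  move: E If0; case: (\int[P]_w f w) => [r| |]//= + r0.
  rewrite lee_fin in r0; rewrite -EFinM -EFinD => -[].
  by move: (L (th / 2)) Lh => l l1 E; congr EFin; lra.
have fae : ae_eq P setT f (cst 0).
  apply/(ae_eq_integral_abs P measurableT mf).
  by under eq_integral do rewrite gee0_abs//.
have Xae : ae_eq P setT (fun w => (X 1%R w)%:E) (cst 1).
  apply: filterS fae => w /= + _ => /(_ Logic.I); rewrite /f => -[].
  move/eqP; rewrite mulf_eq0 orbb subr_eq0 => /eqP s1.
  have : (th / 2 * Y 1 w = 0)%R by apply: expR_inj; rewrite expR0.
  move/eqP; rewrite mulf_eq0 gt_eqF ?divr_gt0//= /net_input subr_eq0.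
  by move=> /eqP ->.
have : 'E_P[X 1%R] = 1.
  rewrite unlock (@ae_eq_integral _ _ _ _ _ (cst 1))//; last exact/measurable_EFinP.
  by rewrite integral_cst//= mul1e probability_setT.
by rewrite EX0 => -[] /eqP; rewrite eq_sym oner_eq0.
Qed.

Lemma cumulant_exponent x : (0 <= x <= b)%R ->
  (x * 1)%:E - cumulant X x = (- ln (L x))%:E.
Proof.
move=> xI; have Lx0 := mgf_gt0 xI.
have -> : cumulant X x = (ln (L x) + x)%:E; last first.
  by rewrite -EFinB; congr EFin; ring.
have ME : 'M_P (X 1%R) x = (L x * expR x)%:E.
  have := mgf_net1E x; rewrite [mgf_net X 1 x](mgfE mY Mb xI) => LE.
  by rewrite EFinM LE -muleA muleC -muleA -EFinM -expRD subrr expR0 mule1.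
rewrite /cumulant ME lne_EFin ?mulr_gt0 ?expR_gt0// lnM ?posrE ?expR_gt0//.
by rewrite expRK.
Qed.

Lemma le_rate x : (0 < x <= b)%R -> (- ln (L x))%:E <= rate X 1.
Proof.
move=> /andP[x0 xb]; rewrite -cumulant_exponent ?(ltW x0)//.
by apply: ereal_sup_ubound; exists x.
Qed.

Lemma mgf_level th : (0 < th <= b)%R -> cumulant X th = th%:E -> L th = 1%R.
Proof.
move=> /andP[th0 thb] cth.
have thI : (0 <= th <= b)%R by rewrite ltW.
have := cumulant_exponent thI; rewrite cth mulr1 -EFinB subrr => -[] /esym/eqP.
by rewrite oppr_eq0 ln_eq0 ?mgf_gt0// => /eqP.
Qed.

(* Chernoff bounds on both tails of the law tilted by [expR (x * Y N)] replace
   its law of large numbers, so only exponential moments are involved. *)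
Lemma tilted_lower_bound (x h al be : R) :
  (0 < h)%R -> (0 <= x - h)%R -> (x + h <= b)%R ->
  (L (x - h) < L x * expR (- (h * al)))%R ->
  (L (x + h) < L x * expR (h * be))%R ->
  exists N0 : nat, forall N : nat, (N0 <= N)%N ->
    ((L x * expR (- (x * be))) ^+ N / 2)%:E <= P [set w | al * N%:R <= Y N%:R w]%R.
Proof.
move=> h0 xh0 xhb.
have xI : (0 <= x <= b)%R by apply/andP; split; lra.
have x0 : (0 <= x)%R by case/andP: xI.
have xlI : (0 <= x - h <= b)%R by apply/andP; split; lra.
have xrI : (0 <= x + h <= b)%R by apply/andP; split; lra.
have mgfN N y : (0 <= y <= b)%R -> mgf_net X N%:R y = (L y ^+ N)%:E.
  move=> yI; have := mgf_net_natmul levyX N y (ler01 : (0 <= 1 :> R)%R); rewrite mulr1 => ->.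
  by rewrite [mgf_net X 1 y](mgfE mY Mb yI) EFin_expe.
have lx0 := mgf_gt0 xI; have ll0 := mgf_gt0 xlI; have lr0 := mgf_gt0 xrI.
move: (fun N => mgfN N _ xI) (fun N => mgfN N _ xlI) (fun N => mgfN N _ xrI).
move: lx0 ll0 lr0 => + + + {mgfN}.
move: (L x) (L (x - h)%R) (L (x + h)%R) => l ll lr l0 ll0 lr0 El Ell Elr Hl Hr.
have lt_div y c : (y < l * expR c)%R -> (y * expR (- c) < l)%R.
  by move=> H; rewrite expRN ltr_pdivrMr ?expR_gt0.
have Hl' := lt_div _ _ Hl; have Hr' := lt_div _ _ Hr.
have [N1 HN1] := expr_ratio_small (mulr_ge0 (ltW ll0) (expR_ge0 _)) Hl'.
have [N2 HN2] := expr_ratio_small (mulr_ge0 (ltW lr0) (expR_ge0 _)) Hr'.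
exists (maxn N1 N2) => N; rewrite geq_max => /andP[/HN1 {}HN1 /HN2 {}HN2].
pose A := [set w | al * N%:R <= Y N%:R w]%R.
have mA : measurable A by apply: measurable_ge; exact: measurable_net_input.
pose c1 := expR (x * be * N%:R).
pose c2 := expR (- (h * be * N%:R)).
pose c3 := expR (h * al * N%:R).
have mN := measurable_net_input X N%:R.
have m1 : measurable_fun setT (fun w => c1%:E * (\1_A w : R)%:E).
  apply: emeasurable_funM; first exact: measurable_cst.
  by apply/measurable_EFinP; exact: measurable_indic.
have m2 c y : measurable_fun setT (fun w => c%:E * (expR (y * Y N%:R w))%:E).
  by apply: emeasurable_funM; [exact: measurable_cst|exact: measurable_expRM].
(* The integrands compare pointwise in the value [s] of [Y N]: between [al * N] and [be * N] the
   indicator term suffices, as [x >= 0]; above [be * N] the [x + h] term does, below [al * N] the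
   [x - h] term. *)
have H : mgf_net X N%:R x <= \int[P]_w (c1%:E * (\1_A w : R)%:E +
    (c2%:E * (expR ((x + h) * Y N%:R w))%:E + c3%:E * (expR ((x - h) * Y N%:R w))%:E)).
  apply: ge0_le_integral => //.
  - exact: measurable_expRM.
  - by apply: emeasurable_funD => //; exact: emeasurable_funD.
  move=> w _; rewrite -!EFinM -!EFinD lee_fin.
  set s := Y N%:R w; rewrite /c1 /c2 /c3 -!expRD.
  have e0 := expR_ge0; have [As|As] := leP (al * N%:R)%R s.
    have -> : \1_A w = 1%R :> R by rewrite indicE mem_set.
    have [Bs|Bs] := leP s (be * N%:R)%R.
      rewrite mulr1 ler_wpDr ?addr_ge0// ler_expR -mulrA ler_wpM2l//.
    rewrite ler_wpDl ?mulr_ge0// ler_wpDr// ler_expR.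
    have : (0 <= h * (s - be * N%:R))%R by apply: mulr_ge0; rewrite ?subr_ge0 ltW.
    lra.
  rewrite ler_wpDl ?mulr_ge0// ler_wpDl// ler_expR.
  have : (0 <= h * (al * N%:R - s))%R by apply: mulr_ge0; rewrite ?subr_ge0 ltW.
  lra.
have {}H : mgf_net X N%:R x <= c1%:E * P A +
    (c2%:E * mgf_net X N%:R (x + h)%R + c3%:E * mgf_net X N%:R (x - h)%R).
  apply: (le_trans H); rewrite ge0_integralD//; last 3 first.
  - by move=> w _; rewrite -EFinM lee_fin mulr_ge0 ?expR_ge0.
  - by move=> w _; rewrite -!EFinM -EFinD lee_fin addr_ge0 ?mulr_ge0 ?expR_ge0.
  - by apply: emeasurable_funD.
  have Z c y : (0 <= c)%R -> \int[P]_w (c%:E * (expR (y * Y N%:R w))%:E) =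
      c%:E * mgf_net X N%:R y.
    by move=> c0; rewrite ge0_integralZl//; exact: measurable_expRM.
  rewrite (ge0_integralD _ _ _ (m2 c2 _) _ (m2 c3 _))//; last 2 first.
  - by move=> w _; rewrite -EFinM lee_fin mulr_ge0 ?expR_ge0.
  - by move=> w _; rewrite -EFinM lee_fin mulr_ge0 ?expR_ge0.
  have Z1 : \int[P]_w (c1%:E * (\1_A w : R)%:E) = c1%:E * P A.
    rewrite ge0_integralZl ?lee_fin ?expR_ge0//; last first.
      by apply/measurable_EFinP; exact: measurable_indic.
    by rewrite integral_indic// setIT.
  by rewrite !Z ?expR_ge0// Z1.
have PAfin : P A \is a fin_num by rewrite fin_num_measure.
move: H; rewrite El Ell Elr -(fineK PAfin) -!EFinM -!EFinD !lee_fin.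
set p := fine (P A).
have -> : (c2 * lr ^+ N = (lr * expR (- (h * be))) ^+ N)%R.
  by rewrite exprMn -expRM_natr mulrC /c2; congr (_ * expR _)%R; ring.
have -> : (c3 * ll ^+ N = (ll * expR (- - (h * al))) ^+ N)%R.
  by rewrite exprMn -expRM_natr mulrC /c3; congr (_ * expR _)%R; ring.
move=> H.
have {}H : (l ^+ N / 2 <= c1 * p)%R by lra.
rewrite exprMn -expRM_natr.
have -> : (l ^+ N * expR (- (x * be) * N%:R) / 2 = l ^+ N / 2 * c1^-1)%R.
  by rewrite /c1 -expRN mulNr; ring.
by rewrite ler_pdivrMr ?expR_gt0// [leRHS]mulrC.
Qed.

End FiniteMgf.

End LevyMgf.

(** * The rate at 1 and Cramer's lower bounds at the two tilts *)

Section Cramer.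
Context (d : measure_display) (Omega : measurableType d) (R : realType)
  (P : probability Omega R) (X : R -> {RV P >-> R}).
Variables (b th : R).
Hypotheses (levyX : levy_process X) (EX0 : 'E_P[X 1%R] = 0)
  (Mb : mgf_net X 1 b < +oo) (th0 : (0 < th)%R) (thb : (th < b)%R)
  (cth : cumulant X th = th%:E).

Local Notation Y := (net_input X).
Local Notation L := (mgf P (Y 1)).

Let mY : measurable_fun setT (Y 1) := measurable_net_input X 1.

Lemma mgf_at_theta : L th = 1%R.
Proof. by apply: (mgf_level EX0 Mb) => //; rewrite th0 ltW. Qed.

Lemma mgf_at_half : (L (th / 2) < 1)%R.
Proof.
by apply: (mgf_half_lt1 EX0 Mb); [rewrite th0 ltW|exact: mgf_at_theta].
Qed.

Lemma mgf_ge1_after x : (th < x)%R -> mgf_net X 1 x < +oo -> (1 <= L x)%R.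
Proof.
move=> thx Mx.
have x0 : (0 < x)%R by exact: lt_trans thx.
have I0 : (0 <= (0 : R) <= x)%R by rewrite lexx ltW.
have Ix : (0 <= x <= x)%R by rewrite lexx ltW.
have It : (0 <= th / x <= 1)%R.
  apply/andP; split; first by apply: divr_ge0; exact: ltW.
  by rewrite ler_pdivrMr// mul1r ltW.
have := mgf_convex mY Mx I0 Ix It; rewrite mulr0 add0r divfK ?gt_eqF//.
rewrite mgf_at_theta mgf0 mulr1.
have tx0 : (0 < th / x)%R by exact: divr_gt0.
by move: (L x) => l H; rewrite -subr_ge0 -(pmulr_rge0 _ tx0); lra.
Qed.

(** Parameters beyond [th] do not raise the supremum: either [L >= 1] there by convexity, and the
    term is at most the value 0 taken at [th], or the moment is infinite and the term is [-oo]. *)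
Lemma rate_le (J : R) : (forall x, 0 < x <= th -> - ln (L x) <= J)%R ->
  rate X 1 <= J%:E.
Proof.
move=> HJ; have J0 : (0 <= J)%R.
  by have := HJ th; rewrite th0 lexx mgf_at_theta ln1 oppr0; exact.
apply: ge_ereal_sup => _ [x /= x0 <-].
have [xth|thx] := leP x th.
  have xI : (0 <= x <= b)%R by rewrite (ltW x0) (le_trans xth)// ltW.
  by rewrite (cumulant_exponent EX0 Mb xI) lee_fin HJ// x0.
have [Mx|] := ltP (mgf_net X 1 x) +oo.
  have xI : (0 <= x <= x)%R by rewrite lexx ltW.
  rewrite (cumulant_exponent EX0 Mx xI) lee_fin.
  by rewrite (le_trans _ J0)// oppr_le0 ln_ge0// mgf_ge1_after.
rewrite leye_eq mgf_net1E => /eqP Mx.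
have -> : cumulant X x = +oo.
  rewrite /cumulant; case: ('M_P (X 1%R) x) (mmt_gen_fun_ge1 EX0 (ltW x0)) Mx => //.
by rewrite addeNy// leNye.
Qed.

(** The term at [th / 2] is already positive, and [L x >= expR (- x)] bounds every term on [(0, th]]
    by [th]. *)
Lemma rate_fin : exists2 I : R, rate X 1 = I%:E & (0 < I)%R.
Proof.
have th2 : (0 < th / 2 <= b)%R.
  by rewrite divr_gt0//= ler_pdivrMr//; move: th0 thb; lra.
have lo := le_rate EX0 Mb th2.
have hi : rate X 1 <= th%:E.
  apply: rate_le => x /andP[x0 xth].
  have xI : (0 <= x <= b)%R by rewrite (ltW x0) (le_trans xth)// ltW.
  have := mgf_ge_expRN EX0 Mb xI.
  rewrite -ler_ln ?posrE ?expR_gt0 ?(mgf_gt0 EX0 Mb)// expRK => Lx.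
  by rewrite lerNl (le_trans _ Lx)// lerN2.
have lo0 : (0 < - ln (L (th / 2)))%R.
  case/andP: th2 => /ltW th20 th2b.
  by rewrite oppr_gt0 ln_lt0// mgf_at_half (mgf_gt0 EX0 Mb)// th20.
exists (fine (rate X 1)).
  rewrite fineK// fin_real// (lt_le_trans _ lo) ?ltNyr//=.
  by rewrite (le_lt_trans hi) ?ltry.
rewrite -lte_fin fineK ?(lt_le_trans _ lo)//.
by rewrite fin_real// (lt_le_trans _ lo) ?ltNyr//= (le_lt_trans hi) ?ltry.
Qed.

Lemma exceed_lower_bound (e : R) : (0 < e)%R ->
  exists C : R, forall u : R, (0 <= u)%R -> exists2 a : R, (0 <= a)%R &
    (expR (- ((1 + e) * (th * u) + C)))%:E <= P [set w | u <= Y a w]%R.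
Proof.
move=> e0.
have thI : (0 < th < b)%R by rewrite th0.
have [al [be [h [[al0 albe Hl] [h0 hl hr Hr]]]]] :=
  slopes_at_level (mgf_convex mY Mb) (mgf_halving mY Mb) thI e0 (mgf0 _ _)
    mgf_at_theta mgf_at_half.
have Ll : (L (th - h) < L th * expR (- (h * al)))%R.
  by rewrite mgf_at_theta mul1r (lt_le_trans Hl)// expR_ge1Dx.
pose be' := ((1 + e) * al)%R.
have be'0 : (0 < be')%R by rewrite mulr_gt0// addr_gt0.
have Lr : (L (th + h) < L th * expR (h * be'))%R.
  rewrite mgf_at_theta mul1r (lt_le_trans Hr)//.
  apply: (le_trans _ (expR_ge1Dx _)).
  by rewrite lerD2l ler_wpM2l// ltW.
have [N0 HN] := tilted_lower_bound levyX EX0 Mb h0 hl hr Ll Lr.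
rewrite mgf_at_theta mul1r in HN.
clear Hl Hr Ll Lr hl hr.
(* The constant pays for rounding [u / al] up to an integer, for starting at [N0], and for the
   factor [1 / 2]. *)
exists (th * be' * (N0%:R + 1) + ln 2)%R => u u0.
pose N := maxn N0 (Num.trunc (u / al)).+1.
exists N%:R => //.
have alN : (u <= al * N%:R)%R.
  rewrite mulrC -ler_pdivrMr//.
  apply: (le_trans (ltW (truncnS_gt _))).
  by rewrite ler_nat leq_maxr.
have Nle : (N%:R <= u / al + (N0%:R + 1))%R.
  have : (N <= N0 + (Num.trunc (u / al)).+1)%N by rewrite geq_max leq_addr leq_addl.
  rewrite -(ler_nat R) natrD -natr1 => NN; apply: (le_trans NN).
  by rewrite addrCA lerD2r truncn_le// divr_ge0// ltW.
apply: (@le_trans _ _ (expR (- (th * be')) ^+ N / 2)%:E).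
  rewrite lee_fin -expRM_natr -[X in (_ / X)%R]lnK ?posrE// -expRN -expRD ler_expR.
  have -> : ((1 + e) * (th * u) = th * be' * (u / al))%R by rewrite /be'; field; rewrite gt_eqF.
  have : (th * be' * N%:R <= th * be' * (u / al + (N0%:R + 1)))%R.
    by rewrite ler_wpM2l// mulr_ge0// ltW.
  lra.
apply: (le_trans (HN N (leq_maxl _ _))); apply: le_measure; rewrite ?inE.
- by apply: measurable_ge; exact: measurable_net_input.
- by apply: measurable_ge; exact: measurable_net_input.
by move=> w /=; exact: le_trans.
Qed.

Lemma nonneg_lower_bound (I e : R) : rate X 1 = I%:E -> (0 < e)%R ->
  exists N0 : nat, forall N : nat, (N0 <= N)%N ->
    (expR (- ((I + e) * N%:R)) / 2)%:E <= P [set w | 0 <= Y N%:R w]%R.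
Proof.
move=> rI e0.
have thI : (0 < th < b)%R by rewrite th0.
(* With this tolerance on the slope, [x < th] gives [x * be <= e]. *)
have eth : (0 < e / th)%R by rewrite divr_gt0.
have [x [be [h [[/andP[x0 xth] bee Hl] [h0 hl hr Hr]]]]] :=
  slopes_near_min (mgf_convex mY Mb) (mgf_halving mY Mb) thI eth
    mgf_at_theta mgf_at_half (mgf_ge_expRN EX0 Mb).
have xI : (0 <= x <= b)%R by rewrite (ltW x0) ltW// (lt_trans xth).
have Lx0 := mgf_gt0 EX0 Mb xI.
have Ll : (L (x - h) < L x * expR (- (h * 0)))%R.
  by rewrite mulr0 oppr0 expR0 mulr1.
have Lr : (L (x + h) < L x * expR (h * be))%R.
  by apply: (lt_le_trans Hr); rewrite ler_wpM2l ?expR_ge1Dx// ltW.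
have [N0 HN] := tilted_lower_bound levyX EX0 Mb h0 hl hr Ll Lr.
exists N0 => N /HN {}HN.
have E : [set w | 0 <= Y N%:R w]%R = [set w | 0 * N%:R <= Y N%:R w]%R.
  by rewrite mul0r.
rewrite E; apply: (le_trans _ HN).
rewrite lee_fin ler_wpM2r ?invr_ge0//.
rewrite -mulNr expRM_natr lerXn2r ?nnegrE ?mulr_ge0 ?expR_ge0 ?(ltW Lx0)//.
have lnL : (- I <= ln (L x))%R.
  rewrite lerNl -lee_fin -rI; apply: (le_rate EX0 Mb).
  by rewrite x0 ltW// (lt_trans xth).
rewrite -[L x]lnK ?posrE// -expRD ler_expR.
have : (x * be <= x * (e / th))%R by rewrite ler_wpM2l// ltW.
have : (x * (e / th) <= th * (e / th))%R by rewrite ler_wpM2r// ltW.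
rewrite [X in (_ <= X)%R -> _]mulrC divfK ?gt_eqF//.
by move: (ln (L x)) lnL (x * be)%R (x * (e / th))%R => l lnl y z; clear Ll Lr Hl Hr; lra.
Qed.

End Cramer.

(** * Cadlag paths and the workload *)

Section CadlagPath.
Context (R : realType).
Local Open Scope ring_scope.

Lemma dyadic_between (a b : R) : 0 <= a -> a < b ->
  exists m i : nat, a < i%:R / 2 ^+ m < b.
Proof.
move=> a0 ab; have ba0 : 0 < b - a by rewrite subr_gt0.
pose m := (Num.trunc (b - a)^-1).+1.
have two0 : (0 : R) < 2 ^+ m by rewrite exprn_gt0.
have mP : (b - a)^-1 < 2 ^+ m.
  by apply: (lt_trans (truncnS_gt _)); rewrite -natrX ltr_nat ltn_expl.
exists m, (Num.trunc (a * 2 ^+ m)).+1; apply/andP; split.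
  by rewrite ltr_pdivlMr// truncnS_gt.
rewrite ltr_pdivrMr// -natr1.
have tr : (Num.trunc (a * 2 ^+ m))%:R <= a * 2 ^+ m.
  by rewrite truncn_le// mulr_ge0// ltW.
have : 1 < (b - a) * 2 ^+ m by rewrite mulrC -ltr_pdivrMr// div1r.
lra.
Qed.

Variable y : R -> R.
Hypothesis y_cadlag : cadlag y.

Lemma right_nbhs (t e : R) : 0 < e ->
  exists2 dl, 0 < dl & forall s, t <= s -> s < t + dl -> `|y s - y t| < e.
Proof.
move=> e0; have [/cvgrPdist_lt/(_ e e0) H _] := y_cadlag t.
move: H; rewrite near_withinE near_simpl => -[dl /= dl0 H].
exists dl => // s; rewrite le_eqVlt => /orP[/eqP <- _|ts sd].
  by rewrite subrr normr0.
rewrite distrC; apply: H => //=.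
by rewrite distrC ger0_norm ?subr_ge0 ?(ltW ts)// ltrBlDl.
Qed.

Lemma left_bounded (t : R) :
  exists2 dl, 0 < dl & exists K, forall s, t - dl < s -> s < t -> - K <= y s.
Proof.
have [_ /cvg_ex[/= l /cvgrPdist_lt/(_ 1 ltr01) H]] := y_cadlag t.
move: H; rewrite near_withinE near_simpl => -[dl /= dl0 H].
exists dl => //; exists (1 - l) => s sd st.
have := H s; rewrite /= ger0_norm ?subr_ge0 ?(ltW st)// => /(_ _ st).
rewrite ltrBlDr -ltrBlDl => /(_ sd).
by rewrite ltr_norml => /andP[_]; lra.
Qed.

(** Real induction: at the supremum of the times up to which a bound exists, the left limit bounds
    the path just before and right-continuity just after, so this supremum cannot lie below [B]. *)
Lemma cadlag_bounded_below (B : R) : 0 <= B ->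
  exists K, forall s, 0 <= s <= B -> - K <= y s.
Proof.
move=> B0.
pose A := [set t | 0 <= t <= B /\ exists K, forall s, 0 <= s <= t -> - K <= y s].
have A0 : A 0.
  split; first by rewrite lexx.
  exists (- y 0) => s /andP[s0 s1]; have -> : s = 0 by apply/eqP; rewrite eq_le s1.
  by rewrite opprK.
have hsA : has_sup A by split; [exists 0|exists B => t [/andP[]]].
set t0 := sup A.
have t00 : 0 <= t0 by apply: sup_upper_bound.
have t0B : t0 <= B by apply: ge_sup; [exists 0|move=> t [/andP[]]].
have [dl dl0 [K1 HK1]] := left_bounded t0.
have [dr dr0 Hr] := right_nbhs t0 ltr01.
have [a [aI [K2 HK2]] at0] : exists2 a, A a & t0 - dl < a.
  by have [a Aa ta] := sup_adherent dl0 hsA; exists a.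
pose t1 := Num.min B (t0 + dr / 2).
pose K := Num.max (Num.max K1 K2) (1 - y t0).
have KP s : 0 <= s <= t1 -> - K <= y s.
  move=> /andP[s0]; rewrite le_min => /andP[sB sdr].
  have [sa|sa] := leP s a.
    apply: le_trans (HK2 s _); last by rewrite s0.
    by rewrite lerN2 !le_max lexx orbT.
  have [st|st] := ltP s t0.
    apply: le_trans (HK1 s _ st); last exact: lt_trans sa.
    by rewrite lerN2 !le_max lexx.
  have std : s < t0 + dr by lra.
  have := Hr s st std; rewrite ltr_norml => /andP[H _].
  have : 1 - y t0 <= K by rewrite le_max lexx orbT.
  lra.
have At1 : A t1.
  split; last by exists K.
  by rewrite le_min B0 ge_min lexx addr_ge0// divr_ge0// ltW.
have : t1 <= t0 by apply: sup_upper_bound.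
rewrite ge_min => /orP[Bt0|]; last by lra.
exists K => s /andP[s0 sB]; apply: KP; rewrite s0 le_min sB/=.
by rewrite (le_trans sB)// (le_trans Bt0)// lerDl divr_ge0// ltW.
Qed.

Lemma dyadic_right (t B e : R) : 0 <= t -> t < B -> 0 < e ->
  exists m i : nat, t < i%:R / 2 ^+ m < B /\ `|y (i%:R / 2 ^+ m) - y t| < e.
Proof.
move=> t0 tB e0; have [dl dl0 H] := right_nbhs t e0.
have tm : t < Num.min B (t + dl) by rewrite lt_min tB ltrDl.
have [m [i /andP[ti]]] := dyadic_between t0 tm.
rewrite lt_min => /andP[iB idl]; exists m, i; rewrite ti iB; split => //.
by apply: H => //; exact: ltW.
Qed.

Lemma dyadic_left_of (t r e : R) : r < t -> 0 < e ->
  exists m i : nat, r < t - i%:R / 2 ^+ m < t /\ `|y (t - i%:R / 2 ^+ m) - y r| < e.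
Proof.
move=> rt e0; have [dl dl0 H] := right_nbhs r e0.
have tm : Num.max 0 (t - r - dl) < t - r.
  by rewrite gt_max subr_gt0 rt/= ltrBlDr ltrDl.
have [|m [i /andP[ti iB]]] := dyadic_between _ tm; first by rewrite le_max lexx.
move: ti; rewrite gt_max => /andP[i0 idl].
exists m, i; split; first by apply/andP; split; lra.
by apply: H; lra.
Qed.

Lemma ge_of_dyadic (B K : R) :
  (forall m i : nat, i%:R / 2 ^+ m <= B -> K <= y (i%:R / 2 ^+ m)) ->
  K <= y B -> forall s, 0 <= s <= B -> K <= y s.
Proof.
move=> H HB s /andP[s0]; rewrite le_eqVlt => /orP[/eqP -> //|sB].
apply/ler_addgt0Pr => e e0.
have [m [i [/andP[si iB] Hi]]] := dyadic_right s0 sB e0.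
have := H m i (ltW iB); move: Hi; rewrite ltr_norml => /andP[]; lra.
Qed.

Local Notation wl t :=
  (ereal_sup [set (y t - y s)%:E | s in [set s : R | s <= t]]).

Lemma workload_gtP (c t : R) :
  (c%:E < wl t)%E <-> exists2 s, s <= t & c < y t - y s.
Proof.
split=> [/ereal_sup_gt[_ [s /= st <-]]|[s st cs]].
  by rewrite lte_fin => cs; exists s.
by apply: (@lt_le_trans _ _ (y t - y s)%:E); [rewrite lte_fin|
  apply: ereal_sup_ubound; exists s].
Qed.

(** A starting time in [(t, s]] contributes only the oscillation of [y] right of [t]. This one
    inequality suffices to carry lower bounds from dyadic times to the times just left of them. *)
Lemma workload_right (t e : R) : 0 < e ->
  exists2 dl, 0 < dl & forall s, t <= s -> s < t + dl -> (wl s <= wl t + e%:E)%E.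
Proof.
move=> e0; have e20 : 0 < e / 2 by rewrite divr_gt0.
have [dl dl0 H] := right_nbhs t e20.
exists dl => // s ts sd; apply: ge_ereal_sup => _ [r /= rs <-].
have [rt|tr] := leP r t.
  have : ((y t - y r)%:E <= wl t)%E by apply: ereal_sup_ubound; exists r.
  move=> /(leeD2r e%:E); apply: le_trans; rewrite -EFinD lee_fin.
  by have := H s ts sd; rewrite ltr_norml => /andP[]; lra.
have : ((y t - y t)%:E <= wl t)%E by apply: ereal_sup_ubound; exists t => /=.
move=> /(leeD2r e%:E); apply: le_trans; rewrite -EFinD lee_fin.
have := H s ts sd; rewrite ltr_norml => /andP[].
have := H r (ltW tr) (le_lt_trans rs sd); rewrite ltr_norml => /andP[].
lra.
Qed.

(* At the first time [t0] where the level [u] is reached by the part of the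
   workload carried over from time [0], the whole workload is at most [u]. *)
Lemma workload_carried (B u : R) : 0 <= u ->
  (forall s, 0 <= s <= B -> (u%:E < wl s)%E) ->
  forall t, 0 <= t <= B -> exists2 s, s <= 0 & u < y t - y s.
Proof.
move=> u0 H t tI; apply: contrapT => Nt.
pose S := [set t | 0 <= t <= B /\ forall s, s <= 0 -> y t - y s <= u].
have St : S t.
  split=> // s s0; rewrite leNgt; apply/negP => us; apply: Nt; by exists s.
have hiS : has_inf S by split; [exists t|exists 0 => r [/andP[]]].
set t0 := inf S.
have t00 : 0 <= t0 by apply: lb_le_inf; [exists t|move=> r [/andP[]]].
have t0B : t0 <= B.
  by apply: (@le_trans _ _ t); [apply: inf_lbound => //; case: hiS|case/andP: tI].
have S0 s : s <= 0 -> y t0 - y s <= u.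
  move=> s0; apply/ler_addgt0Pr => e e0.
  have [dl dl0 Hd] := right_nbhs t0 e0.
  have [r Sr rd] := inf_adherent dl0 hiS.
  have t0r : t0 <= r by apply: inf_lbound => //; case: hiS.
  have := Hd r t0r rd; rewrite ltr_norml => /andP[].
  by case: Sr => _ /(_ s s0); lra.
have t0I : 0 <= t0 <= B by rewrite t00.
have /workload_gtP[s st us] := H t0 t0I.
have [s0|s0] := leP s 0; first by have := S0 s s0; lra.
have [st0|t0s] := ltP s t0; last first.
  by have E : s = t0 by [apply/eqP; rewrite eq_le st]; move: us; rewrite E; lra.
(* From [y t0 - y s > u] with [0 < s < t0] follows [y s - y r < 0 <= u] for all [r <= 0], so [s]
   would belong to [S] below its infimum. *)
have : ~ S s by move=> Ss; have := inf_lbound (proj2 hiS) Ss; rewrite leNgt st0.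
apply; split; first by rewrite (ltW s0) (le_trans st).
by move=> r r0; have := S0 r r0; lra.
Qed.

Lemma workload_carried_dyadic (B u : R) : 0 <= u -> 0 <= B ->
  (forall s, 0 <= s <= B -> (u%:E < wl s)%E) ->
  exists m i : nat, [/\ (0 < i)%N, u < y 0 - y (- (i%:R / 2 ^+ m)) &
                     u < y B - y (- (i%:R / 2 ^+ m))].
Proof.
move=> u0 B0 H.
have I0 : 0 <= (0 : R) <= B by rewrite lexx.
have IB : 0 <= B <= B by rewrite lexx B0.
have [s1 s10 us1] := workload_carried u0 H I0.
have [s2 s20 us2] := workload_carried u0 H IB.
(* Of the two starting times, the one with the lower value of [y] serves both end points. *)
have [s [s0 su0 suB]] : exists s, [/\ s <= 0, u < y 0 - y s & u < y B - y s].
  have [y12|y12] := leP (y s1) (y s2); first by exists s1; split => //; lra.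
  by exists s2; split => //; lra.
have {s0}s0 : s < 0.
  rewrite lt_neqAle s0 andbT; apply/eqP => sE.
  by move: su0; rewrite sE subrr; lra.
pose e := Num.min (y 0 - y s - u) (y B - y s - u).
have e0 : 0 < e by rewrite lt_min !subr_gt0 su0.
have [m [i [/andP[_ i0] Hi]]] := dyadic_left_of s0 e0.
rewrite sub0r in i0 Hi.
move: Hi; rewrite ltr_norml => /andP[_]; rewrite lt_min => /andP[H1 H2].
exists m, i; split; try lra.
by rewrite lt0n; apply/eqP => iE; move: i0; rewrite iE mul0r oppr0 ltxx.
Qed.

Local Notation wl_inf B :=
  (ereal_inf [set wl s | s in [set s : R | 0 <= s <= B]]).

(** Only countable operations occur on the right, which yields measurability. The margin
    [k.+1%:R^-1] accounts for an infimum strictly above [u]; times are counted backwards from [B] so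
    that [B] itself, which has no time of the interval on its right, is included. *)
Lemma inf_workload_gtP (B u : R) : 0 <= u -> 0 <= B ->
  (u%:E < wl_inf B)%E <->
  exists k : nat, forall m j : nat, j%:R / 2 ^+ m <= B ->
    exists n i : nat, u + k.+1%:R^-1 <
      y (B - j%:R / 2 ^+ m) - y (B - j%:R / 2 ^+ m - i%:R / 2 ^+ n).
Proof.
move=> u0 B0; split => [uB|[k H]].
  have [k kB] : exists k : nat, ((u + k.+1%:R^-1)%:E < wl_inf B)%E.
    move: uB; case: (wl_inf B) => [r| |]//.
    - rewrite lte_fin => ur; exists (Num.trunc (r - u)^-1).
      have ru : 0 < r - u by rewrite subr_gt0.
      rewrite lte_fin -ltrBrDl invf_plt ?posrE//.
      exact: truncnS_gt.
    - by move=> _; exists 0%N; rewrite ltry.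
  exists k => m j jB; set s := B - _.
  have k0 : 0 < (k.+1%:R^-1 : R) by rewrite invr_gt0.
  move: (k.+1%:R^-1 : R) kB k0 => q kB q0.
  have sI : 0 <= s <= B by rewrite /s subr_ge0 jB gerBl divr_ge0.
  have : ((u + q)%:E < wl s)%E.
    by apply: (lt_le_trans kB); apply: ereal_inf_lbound; exists s.
  move=> /workload_gtP[r]; rewrite le_eqVlt => /orP[/eqP ->|rs us].
    by rewrite subrr ltNge addr_ge0// ltW.
  have e0 : 0 < y s - y r - (u + q) by rewrite subr_gt0.
  have [n [i [_ Hi]]] := dyadic_left_of rs e0.
  by exists n, i; move: Hi; rewrite ltr_norml => /andP[]; lra.
have k0 : 0 < k.+1%:R^-1 :> R by rewrite invr_gt0.
set c := u + k.+1%:R^-1 in H.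
have Hd m j : j%:R / 2 ^+ m <= B -> (c%:E <= wl (B - j%:R / 2 ^+ m)%R)%E.
  move=> /H[n [i ci]]; apply/ltW/workload_gtP.
  by exists (B - j%:R / 2 ^+ m - i%:R / 2 ^+ n)%R => //; rewrite gerBl divr_ge0.
apply: (@lt_le_trans _ _ c%:E); first by rewrite lte_fin ltrDl.
apply: le_ereal_inf_tmp => _ [s /= /andP[s0 sB] <-].
move: sB; rewrite [(s <= B)%R]le_eqVlt => /orP[/eqP ->|sB].
  by have := Hd 0%N 0%N; rewrite mul0r subr0; apply.
apply/lee_addgt0Pr => e e0.
have [dl dl0 Hw] := workload_right s e0.
have tm : Num.max 0 (B - s - dl) < B - s.
  by rewrite gt_max subr_gt0 sB/= ltrBlDr ltrDl.
have [|m [j /andP[]]] := dyadic_between _ tm; first by rewrite le_max lexx.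
rewrite gt_max => /andP[j0 jdl] jB.
have jB' : j%:R / 2 ^+ m <= B by lra.
by apply: (le_trans (Hd _ _ jB')); apply: Hw; lra.
Qed.

(** The extra 1 in the starting level keeps the infimum strictly above [u]. [B] stands for the end
    of the last block, possibly beyond [T]. *)
Lemma inf_workload_gt (B T u K a : R) : 0 <= a -> 0 <= T <= B ->
  u + K + 1 <= y 0 - y (- a) ->
  (forall m i : nat, i%:R / 2 ^+ m <= B -> - K <= y (i%:R / 2 ^+ m) - y 0) ->
  - K <= y B - y 0 ->
  (u%:E < wl_inf T)%E.
Proof.
move=> a0 /andP[T0 TB] Ha HK HB.
apply: (@lt_le_trans _ _ (u + 1)%:E); first by rewrite lte_fin ltrDl.
apply: le_ereal_inf_tmp => _ [s /= /andP[s0 sT] <-].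
have sI : 0 <= s <= B by rewrite s0 (le_trans sT).
have Ks : y 0 - K <= y s.
  apply: (ge_of_dyadic _ _ sI); last by lra.
  by move=> m i /HK; lra.
apply: (@le_trans _ _ (y s - y (- a))%:E); first by rewrite lee_fin; lra.
by apply: ereal_sup_ubound; exists (- a) => //=; lra.
Qed.

End CadlagPath.

(** * Uniform bounds on the minimal workload *)

Section WorkloadProbability.
Context (d : measure_display) (Omega : measurableType d) (R : realType)
  (P : probability Omega R) (X : R -> {RV P >-> R}).
Hypothesis levyX : levy_process X.

Local Notation Y := (net_input X).

Lemma cadlag_net_input w : cadlag (fun t => Y t w).
Proof.
move=> t; have [Hr /cvg_ex[/= l Hl]] := levy_cadlag levyX w t; split.
  apply: cvgB; first exact: Hr.
  by apply: cvg_at_right_filter; exact: cvg_id.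
apply/cvg_ex; exists (l - t)%R; apply: cvgB; first exact: Hl.
by apply: cvg_at_left_filter; exact: cvg_id.
Qed.

Lemma measurable_gt d' (T : measurableType d') (f : T -> R) (c : R) :
  measurable_fun setT f -> measurable [set x | c < f x]%R.
Proof.
by move=> mf; rewrite -[[set _ | _]]setTI; apply: measurable_fun_ltr.
Qed.

Lemma measurable_min_workload (u B : R) : (0 <= u)%R -> (0 <= B)%R ->
  measurable [set w | u%:E < min_workload X B w].
Proof.
move=> u0 B0.
pose A k m j n i := [set w | u + k.+1%:R^-1 <
  Y (B - j%:R / 2 ^+ m) w - Y (B - j%:R / 2 ^+ m - i%:R / 2 ^+ n) w]%R.
have mA k m j n i : measurable (A k m j n i).
  by apply: measurable_gt; apply: measurable_funB; exact: measurable_net_input.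
pose C k m j := if (j%:R / 2 ^+ m <= B)%R then
   \bigcup_n \bigcup_i A k m j n i else setT.
have mC k m j : measurable (C k m j).
  rewrite /C; case: ifP => // _.
  by apply: bigcupT_measurable => n; apply: bigcupT_measurable.
rewrite (_ : [set _ | _] = \bigcup_k \bigcap_m \bigcap_j C k m j).
  apply: bigcupT_measurable => k; apply: bigcapT_measurable => m.
  exact: bigcapT_measurable.
apply/seteqP; split => w /=.
  move=> /(inf_workload_gtP (cadlag_net_input w) u0 B0)[k H].
  exists k => // m _ j _; rewrite /C; case: ifPn => // jB.
  by have [n [i Hi]] := H m j jB; exists n => //; exists i.
move=> [k _ H]; apply/(inf_workload_gtP (cadlag_net_input w) u0 B0).
exists k => m j jB; have := H m Logic.I j Logic.I; rewrite /C jB.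
by move=> [n _ [i _ Hi]]; exists n, i.
Qed.

Lemma min_workload_le (B B' : R) w : (B <= B')%R ->
  min_workload X B' w <= min_workload X B w.
Proof.
move=> BB'; apply: ereal_inf_le_tmp => _ [s /= /andP[s0 sB] <-].
by exists s => //=; rewrite s0 (le_trans sB).
Qed.

Lemma lindley_ge n k t w : (k <= n)%N ->
  (Y (t n) w - Y (t k) w <= lindley n (increments X t w))%R.
Proof.
elim: n => [|n IH]; first by rewrite leqn0 => /eqP ->; rewrite subrr.
rewrite leq_eqVlt => /orP[/eqP ->|kn]; rewrite /= le_max.
  by rewrite subrr lexx orbT.
have := IH kn; rewrite /increments; set q := lindley _ _.
by move=> H; apply/orP; left; lra.
Qed.

(** Halving the time step takes the square root of the moment. *)
Lemma mgf_net_dyadic_le1 th m : mgf_net X 1 th = 1 ->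
  mgf_net X (1 / 2 ^+ m)%R th <= 1.
Proof.
move=> th1; elim: m => [|m IH]; first by rewrite expr0 divr1 th1.
have h0 : (0 <= 1 / 2 ^+ m.+1 :> R)%R by rewrite divr_ge0.
have := mgf_net_natmul levyX 2 th h0.
rewrite (_ : (2%:R * (1 / 2 ^+ m.+1) = 1 / 2 ^+ m)%R); last first.
  by rewrite exprS; field; rewrite expf_neq0.
move=> E; move: IH; rewrite E.
have := mgf_net_ge0 X (1 / 2 ^+ m.+1)%R th.
case: (mgf_net _ _ _) => [r| |]//.
  by rewrite -EFin_expe !lee_fin => r0; rewrite expr_le1.
Qed.

Lemma grid_crossing (u th x : R) (m N : nat) (n : nat) :
  (0 <= x <= th)%R -> mgf_net X 1 th = 1 ->
  P (\bigcup_(i < N.+1) [set w | (u < Y 0 w - Y (- (i%:R / 2 ^+ m))%R w)%R /\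
                          (u < Y n%:R w - Y (- (i%:R / 2 ^+ m))%R w)%R]) <=
  (expR (- (th * u)))%:E * mgf_net X n%:R x.
Proof.
move=> xth th1.
pose h : R := (1 / 2 ^+ m)%R.
have h0 : (0 <= h)%R by rewrite divr_ge0.
(* [N] steps of mesh [h] lead up to time 0, and one long step goes from 0 to [n]; the moment
   condition at [th] concerns the former only. *)
pose t (i : nat) : R := if (i <= N)%N then (- ((N - i)%:R * h))%R else n%:R.
have ndt : nondecreasing_seq t.
  apply/nondecreasing_seqP => i; rewrite /t; case: (ltnP i N) => iN.
    by rewrite (ltnW iN) lerN2 ler_wpM2r// ler_nat leq_sub2l.
  by case: ifP => // _; rewrite (@le_trans _ _ 0%R)// oppr_le0 mulr_ge0.
have tN : t N = 0%R by rewrite /t leqnn subnn mul0r oppr0.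
have tN1 : t N.+1 = n%:R by rewrite /t ltnn.
have mgf1 i : (i < N)%N -> mgf_net X (t i.+1 - t i) th <= 1.
  move=> iN; rewrite /t iN (ltnW iN).
  have -> : (- ((N - i.+1)%:R * h) - - ((N - i)%:R * h) = 1 / 2 ^+ m)%R.
    by rewrite -(subnSK iN) -natr1 /h; ring.
  exact: mgf_net_dyadic_le1.
have := lindley_end_tail levyX u xth ndt mgf1.
rewrite tN tN1 subr0; apply: le_trans; apply: le_measure; rewrite ?inE.
- apply: bigcup_measurable => i _; apply: measurableI;
    by apply: measurable_gt; apply: measurable_funB; exact: measurable_net_input.
- rewrite -[[set _ | _]]setTI; apply: measurable_fun_ltr => //.
    apply: measurable_maxr; first exact: measurable_cst.
    apply: measurable_funB; first exact: measurable_cst.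
    by apply: measurable_funB; exact: measurable_net_input.
  apply: (measurableT_comp (@measurable_lindley R N N (leqnn N))).
  exact: measurable_increments.
move=> w [i /=]; rewrite ltnS => iN [H1 H2].
have := lindley_ge t w (leq_subr i N).
rewrite tN {1}/t leq_subr subKn// /h mulrA mulr1.
rewrite gt_max /increments tN tN1 => Hl.
by apply/andP; split; lra.
Qed.

Lemma min_workload_upper (u th x : R) (n : nat) : (0 <= u)%R ->
  (0 <= x <= th)%R -> mgf_net X 1 th = 1 ->
  P [set w | u%:E < min_workload X n%:R w] <=
  (expR (- (th * u)))%:E * mgf_net X n%:R x.
Proof.
move=> u0 xth th1.
pose A m i := [set w | (u < Y 0 w - Y (- (i%:R / 2 ^+ m))%R w)%R /\
                       (u < Y n%:R w - Y (- (i%:R / 2 ^+ m))%R w)%R].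
(* Mesh and horizon grow together, with step [1 / 2 ^+ m] back to time [- m]: the [G m] increase and
   exhaust all dyadic times. *)
pose G m := \bigcup_(i < (m * 2 ^ m).+1) A m i.
have mA m i : measurable (A m i).
  by apply: measurableI; apply: measurable_gt; apply: measurable_funB; exact: measurable_net_input.
have mG m : measurable (G m) by exact: bigcup_measurable.
have mUG : measurable (\bigcup_m G m) by exact: bigcupT_measurable.
have A_refine m i l : A m i = A (m + l)%N (i * 2 ^ l)%N.
  rewrite /A; suff -> : (i%:R / 2 ^+ m = (i * 2 ^ l)%:R / 2 ^+ (m + l) :> R)%R by [].
  by rewrite natrM natrX exprD invfM mulrACA divff ?mulr1// expf_neq0.
have ndG : nondecreasing_seq G.
  apply/nondecreasing_seqP => m; apply/subsetPset => w [i /=]; rewrite ltnS => im.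
  rewrite (A_refine m i 1%N) addn1 => Ai; exists (i * 2 ^ 1)%N => //=.
  by rewrite ltnS expn1 expnS (mulnC 2%N) mulnA leq_mul2r/= (leq_trans im)// leq_mul2r leqnSn orbT.
apply: (@le_trans _ _ (P (\bigcup_m G m))).
  apply: le_measure; rewrite ?inE//; first exact: measurable_min_workload.
  move=> w /= uw.
  have H s : (0 <= s <= n%:R)%R -> u%:E < workload X s w.
    by move=> sn; apply: (lt_le_trans uw); apply: ereal_inf_lbound; exists s.
  have [m [i [_ H1 H2]]] := workload_carried_dyadic (cadlag_net_input w) u0 (ler0n R n) H.
  exists (maxn m i) => //; exists (i * 2 ^ (maxn m i - m))%N => /=.
    by rewrite ltnS leq_mul ?leq_maxr// leq_exp2l// leq_subr.
  by have := A_refine m i (maxn m i - m)%N; rewrite subnKC ?leq_maxl// => <-.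
have cG := nondecreasing_cvg_mu mG mUG ndG (mu := P).
rewrite -(cvg_lim _ cG)//; apply: lime_le; first by apply/cvg_ex; eexists; exact: cG.
by apply: nearW => m; exact: grid_crossing.
Qed.

End WorkloadProbability.

(** * Chaining blocks in continuous time *)

Section WorkloadLowerBound.
Context (d : measure_display) (Omega : measurableType d) (R : realType)
  (P : probability Omega R) (X : R -> {RV P >-> R}).
Hypothesis levyX : levy_process X.

Local Notation Y := (net_input X).

(** Constraining dyadic times only keeps the event measurable; right-continuity supplies the other
    times. The end condition is what lets blocks be chained. *)
Definition stay_event (K : R) (N : nat) : set Omega :=
  [set w | (forall m i : nat, (i%:R / 2 ^+ m <= N%:R :> R)%R ->
              (- K <= Y (i%:R / 2 ^+ m)%R w)%R) /\ (0 <= Y N%:R w)%R].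

Lemma measurable_stay_event K N : measurable (stay_event K N).
Proof.
pose C m i := if (i%:R / 2 ^+ m <= N%:R :> R)%R then
  [set w | - K <= Y (i%:R / 2 ^+ m)%R w]%R else setT.
rewrite (_ : stay_event K N =
    (\bigcap_m \bigcap_i C m i) `&` [set w | 0 <= Y N%:R w]%R).
  apply: measurableI; last by apply: measurable_ge; exact: measurable_net_input.
  apply: bigcapT_measurable => m; apply: bigcapT_measurable => i.
  rewrite /C; case: ifP => // _.
  by apply: measurable_ge; exact: measurable_net_input.
apply/seteqP; split => w /= [H wN]; split => //.
  by move=> m _ i _; rewrite /C; case: ifPn => // /H.
by move=> m i iN; have := H m Logic.I i Logic.I; rewrite /C iN.
Qed.

(** As [K] grows the events increase to [0 <= Y N], because cadlag paths are bounded below on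
    [[0, N]]; so some [K] retains half of a positive probability. *)
Lemma stay_event_half N : 0 < P [set w | 0 <= Y N%:R w]%R ->
  exists2 K : R, (0 <= K)%R &
    P [set w | 0 <= Y N%:R w]%R * (2^-1)%:E <= P (stay_event K N).
Proof.
set p := P _ => p0; apply: contrapT => NK.
have mC (k : nat) : measurable (stay_event k%:R N) by exact: measurable_stay_event.
have mU : measurable (\bigcup_k stay_event k%:R N) by exact: bigcupT_measurable.
have ndC : nondecreasing_seq (fun k : nat => stay_event k%:R N).
  move=> k l kl; apply/subsetPset => w [H1 H2]; split => // m i iN.
  by apply: le_trans (H1 m i iN); rewrite lerN2 ler_nat.
have UE : \bigcup_k stay_event k%:R N = [set w | 0 <= Y N%:R w]%R.
  apply/seteqP; split => [w [k _ []]//|w /= w0].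
  have [K HK] := cadlag_bounded_below (cadlag_net_input levyX w) (ler0n R N).
  exists (Num.trunc `|K|).+1 => //; split => // m i iN.
  apply: le_trans (HK (i%:R / 2 ^+ m)%R _); last by rewrite iN divr_ge0.
  rewrite lerN2 (le_trans (ler_norm K))//; apply: ltW; exact: truncnS_gt.
have cC := nondecreasing_cvg_mu mC mU ndC (mu := P).
have pfin : p \is a fin_num.
  by rewrite fin_num_measure//; apply: measurable_ge; exact: measurable_net_input.
have : p <= p * (2^-1)%:E.
  rewrite [leLHS](_ : _ = P (\bigcup_k stay_event k%:R N)); last by rewrite UE.
  rewrite -(cvg_lim _ cC)//; apply: lime_le; first by apply/cvg_ex; eexists; exact: cC.
  apply: nearW => k /=; rewrite leNgt; apply/negP => H; apply: NK.
  by exists k%:R => //; exact: ltW.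
move: p0; rewrite -(fineK pfin) -EFinM lte_fin lee_fin; lra.
Qed.

Lemma min_workload_lower (u T a K : R) (N n : nat) :
  (0 <= u)%R -> (0 <= T)%R -> (0 <= a)%R -> (0 <= K)%R -> (T <= (n * N)%:R)%R ->
  P [set w | u + K + 1 <= Y a w]%R * P (stay_event K N) ^+ n <=
  P [set w | u%:E < min_workload X T w].
Proof.
move=> u0 T0 a0 K0 TnN.
(* For every mesh, [r m] steps make a block of length [N]: one block probability serves all meshes,
   and the bound survives the decreasing intersection over [m]. *)
pose h m : R := ((2 ^+ m)^-1)%R.
have h0 m : (0 <= h m)%R by rewrite invr_ge0.
pose r m := (N * 2 ^ m)%N.
have rh m : ((r m)%:R * h m = N%:R)%R by rewrite /r natrM natrX mulfK// expf_neq0.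
pose G m := [set w | forall i, (i <= n * r m)%N -> (- K <= Y (i%:R * h m)%R w)%R].
pose A := [set w | u + K + 1 <= - Y (- a)%R w]%R.
have mA : measurable A.
  by apply: measurable_ge; apply: measurableT_comp => //; exact: measurable_net_input.
have mG m : measurable (G m) by exact: (measurable_grid_ge X (fun i => i%:R * h m)%R).
have mAG m : measurable (A `&` G m) by exact: measurableI.
have mI : measurable (\bigcap_m (A `&` G m)) by exact: bigcapT_measurable.
have niG : nonincreasing_seq (fun m => A `&` G m).
  apply/nonincreasing_seqP => m; apply/subsetPset => w [Aw Gw]; split => // i im.
  have := Gw (i * 2)%N; rewrite /h exprS natrM invfM mulrA mulfK//; apply.
  by rewrite /r expnS (mulnC 2%N) !mulnA leq_mul2r/= -mulnA.
have PG m : P (stay_event K N) ^+ n <= P (G m).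
  apply: (@persistence _ _ _ _ _ levyX K (h m) (r m) (P (stay_event K N)) n K0 (h0 m)) => //.
  apply: le_measure; rewrite ?inE; first exact: measurable_stay_event.
    apply: measurableI; first exact: (measurable_grid_ge X (fun i => i%:R * h m)%R).
    by apply: measurable_ge; exact: measurable_net_input.
  move=> w [H1 H2]; split; last by rewrite rh.
  move=> i ir; apply: H1; rewrite -[leLHS]/(i%:R * h m)%R -(rh m).
  by rewrite ler_wpM2r// ler_nat.
have PAG m : P [set w | u + K + 1 <= Y a w]%R * P (stay_event K N) ^+ n <= P (A `&` G m).
  rewrite [leRHS](start_persistence levyX (u + K + 1)%R K (n * r m) a0 (h0 m)).
  by apply: lee_pmul => //; [rewrite expe_ge0|exact: PG].
apply: (@le_trans _ _ (P (\bigcap_m (A `&` G m)))).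
  have cG := nonincreasing_cvg_mu _ mAG mI niG (mu := P).
  have {}cG : (P \o (fun m => A `&` G m)) @ \oo --> P (\bigcap_m (A `&` G m)).
    by apply: cG; rewrite -ge0_fin_numE// fin_num_measure.
  rewrite -(cvg_lim _ cG)//; apply: lime_ge; first by apply/cvg_ex; eexists; exact: cG.
  by apply: nearW => m; exact: PAG.
apply: le_measure; rewrite ?inE//.
  exact: measurable_min_workload.
move=> w H /=.
have HA : A w by have [] := H 0%N Logic.I.
apply: (@inf_workload_gt _ _ (cadlag_net_input levyX w) (n * N)%:R T u K a) => //.
- by rewrite T0.
- by rewrite (net_input0 levyX) sub0r.
- move=> m i iN; rewrite (net_input0 levyX) subr0.
  have [_ Gw] := H m Logic.I; apply: Gw.
  rewrite -(ler_nat R) /r mulnA natrM natrX -ler_pdivrMr//.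
- have [_ Gw] := H 0%N Logic.I.
  have := Gw (n * N)%N; rewrite (net_input0 levyX) subr0 /h expr0 invr1 mulr1; apply.
  by rewrite /r expn0 muln1.
Qed.

End WorkloadLowerBound.

Section UniformBounds.
Context (d : measure_display) (Omega : measurableType d) (R : realType)
  (P : probability Omega R) (X : R -> {RV P >-> R}).
Variables (b th I : R).
Hypotheses (levyX : levy_process X) (EX0 : 'E_P[X 1%R] = 0)
  (Mb : mgf_net X 1 b < +oo) (th0 : (0 < th)%R) (thb : (th < b)%R)
  (cth : cumulant X th = th%:E) (rI : rate X 1 = I%:E) (I0 : (0 < I)%R).

Local Notation Y := (net_input X).
Local Notation L := (mgf P (Y 1)).

(** Rounding [T] down to [n] costs at most [expR I]. The bounds for all [x] in [(0, th]] say that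
    [- ln (L x) <= J], hence [rate X 1 <= J], which is the optimised bound without choosing a
    minimiser. *)
Lemma overflow_upper (u T : R) : (0 <= u)%R -> (0 <= T)%R ->
  P [set w | u%:E < min_workload X T w] <= (expR (I - (th * u + T * I)))%:E.
Proof.
move=> u0 T0; pose n := Num.trunc T.
have nT : (n%:R <= T)%R by rewrite truncn_le.
have Tn : (T <= n%:R + 1)%R by rewrite natr1 ltW// truncnS_gt.
have mY := measurable_net_input X 1.
have thI : (0 <= th <= b)%R by rewrite !ltW.
have L1 : mgf_net X 1 th = 1.
  by rewrite [LHS](mgfE mY Mb thI) (mgf_at_theta EX0 Mb th0 thb cth).
have mV B : (0 <= B)%R -> measurable [set w | u%:E < min_workload X B w].
  exact: measurable_min_workload.
pose V := [set w | u%:E < min_workload X n%:R w].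
have VT : P [set w | u%:E < min_workload X T w] <= P V.
  apply: le_measure; rewrite ?inE; [exact: mV|exact: mV|].
  by move=> w /= /lt_le_trans; apply; exact: min_workload_le.
apply: (le_trans VT).
have PVfin : P V \is a fin_num by rewrite fin_num_measure//; exact: mV.
have up x : (0 <= x <= th)%R -> (fine (P V) <= expR (- (th * u)) * L x ^+ n)%R.
  move=> xth; have := min_workload_upper levyX n u0 xth L1.
  have := mgf_net_natmul levyX n x (ler01 : (0 <= 1 :> R)%R); rewrite mulr1 => ->.
  have xI : (0 <= x <= b)%R.
    by case/andP: xth => -> xth; rewrite (le_trans xth)// ltW.
  by rewrite [mgf_net X 1 x](mgfE mY Mb xI) -EFin_expe -EFinM -{1}(fineK PVfin) lee_fin.
rewrite -(fineK PVfin) lee_fin.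
have [p0|p0] := leP (fine (P V)) 0%R; first exact: le_trans (expR_ge0 _).
have [n0|n0] := posnP n.
  have := up th; rewrite (ltW th0) lexx n0 expr0 mulr1 => /(_ isT) /le_trans.
  apply; rewrite ler_expR; move: Tn; rewrite n0 add0r => T1.
  have : (T * I <= 1 * I)%R by rewrite ler_wpM2r// ltW.
  lra.
have n0R : (0 < n%:R :> R)%R by rewrite ltr0n.
pose J := (- (ln (fine (P V)) + th * u) / n%:R)%R.
have IJ : (I <= J)%R.
  rewrite -lee_fin -rI; apply: (rate_le EX0 Mb th0 thb cth) => x /andP[x0 xth].
  have xI : (0 <= x <= b)%R by rewrite (ltW x0) (le_trans xth)// ltW.
  have Lx0 := mgf_gt0 EX0 Mb xI.
  have := up x; rewrite (ltW x0) xth => /(_ isT).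
  rewrite -ler_ln ?posrE ?mulr_gt0 ?expR_gt0 ?exprn_gt0//.
  rewrite lnM ?posrE ?expR_gt0 ?exprn_gt0// expRK lnXn// -mulr_natr.
  by move: (ln (L x)) => l H; rewrite /J ler_pdivlMr//; lra.
rewrite -[leLHS]lnK ?posrE// ler_expR.
move: IJ; rewrite /J ler_pdivlMr// => IJ.
have : (T * I <= (n%:R + 1) * I)%R by rewrite ler_wpM2r// ltW.
lra.
Qed.

Lemma overflow_lower (e : R) : (0 < e)%R -> exists C : R, forall u T : R,
  (0 <= u)%R -> (0 <= T)%R ->
  (expR (- ((1 + e) * (th * u + T * I) + C)))%:E <=
  P [set w | u%:E < min_workload X T w].
Proof.
move=> e0.
have [C1 HC1] := exceed_lower_bound levyX EX0 Mb th0 thb cth e0.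
have e'0 : (0 < e * I / 2)%R by rewrite divr_gt0// mulr_gt0.
have [N0 HN0] := nonneg_lower_bound levyX EX0 Mb th0 thb cth rI e'0.
(* Each block loses a factor [1 / 2] in Cramer's bound and another in [stay_event_half]; for this
   [N] both are absorbed by [e * I / 2 * N]. *)
pose N := maxn N0 (Num.trunc (ln 4 / (e * I / 2))).+1.
have N_gt0 : (0 < N)%N by rewrite leq_max orbT.
have NR : (0 < N%:R :> R)%R by rewrite ltr0n.
have lnN : (ln 4 <= e * I / 2 * N%:R)%R.
  rewrite [leRHS]mulrC -ler_pdivrMr//; apply: (le_trans (ltW (truncnS_gt _))).
  by rewrite ler_nat leq_maxr.
have pN := HN0 N (leq_maxl _ _).
have [K K0 HK] : exists2 K : R, (0 <= K)%R &
    P [set w | 0 <= Y N%:R w]%R * (2^-1)%:E <= P (stay_event X K N).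
  by apply: stay_event_half => //; apply: lt_le_trans pN; rewrite lte_fin divr_gt0// expR_gt0.
have stayN : (expR (- ((1 + e) * I * N%:R)))%:E <= P (stay_event X K N).
  apply: le_trans HK; apply: (@le_trans _ _ ((expR (- ((I + e * I / 2) * N%:R)) / 2)%:E * (2^-1)%:E)).
    have quarter (x : R) : (x / 2 * 2^-1 = x * expR (- ln 4))%R.
      by rewrite expRN lnK ?posrE//; field.
    by rewrite -EFinM lee_fin quarter -expRD ler_expR; lra.
  by rewrite lee_wpmul2r// lee_fin invr_ge0.
(* In order: the extra level [K + 1], the constant of the starting bound, and the last block, which
   may overshoot [T] by up to [N]. *)
exists ((1 + e) * (th * (K + 1)) + C1 + (1 + e) * I * N%:R)%R => u T u0 T0.
have uK0 : (0 <= u + K + 1)%R by rewrite !addr_ge0.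
have [a a0 Ha] := HC1 _ uK0.
pose n := (Num.trunc (T / N%:R)).+1.
have Tn : (T <= (n * N)%:R)%R.
  by rewrite natrM -ler_pdivrMr//; apply: ltW; exact: truncnS_gt.
have nT : (n%:R * N%:R <= T + N%:R)%R.
  rewrite -natr1 mulrDl mul1r lerD2r -ler_pdivlMr//.
  by rewrite truncn_le// divr_ge0// ltW.
apply: le_trans (min_workload_lower levyX u0 T0 a0 K0 Tn).
have stayn : (expR (- ((1 + e) * I * (T + N%:R))))%:E <= P (stay_event X K N) ^+ n.
  apply: (@le_trans _ _ ((expR (- ((1 + e) * I * N%:R)))%:E ^+ n)); last first.
    rewrite -(fineK (fin_num_measure P _ (measurable_stay_event X K N))) in stayN *.
    rewrite -!EFin_expe lee_fin lerXn2r ?nnegrE ?expR_ge0//.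
    by rewrite fine_ge0.
  rewrite -EFin_expe lee_fin -expRM_natr ler_expR.
  have eI0 : (0 <= (1 + e) * I)%R by rewrite mulr_ge0// ltW// addr_gt0.
  by have := ler_wpM2l eI0 nT; lra.
apply: (@le_trans _ _ ((expR (- ((1 + e) * (th * (u + K + 1)) + C1)))%:E *
   (expR (- ((1 + e) * I * (T + N%:R))))%:E)).
  by rewrite -EFinM -expRD lee_fin ler_expR; lra.
by apply: lee_pmul => //; rewrite lee_fin expR_ge0.
Qed.

End UniformBounds.

Theorem theorem5 (d : measure_display) (Omega : measurableType d)
    (R : realType) (P : probability Omega R) (X : R -> {RV P >-> R})
    (theta_star : R) (T : R -> R) :
  levy_process X ->
  'E_P[X 1%R] = 0 ->
  0 < beta_star X ->
  (0 < theta_star)%R -> theta_star%:E < beta_star X ->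
  cumulant X theta_star = theta_star%:E ->
  (forall u : R, (0 < u)%R -> (0 <= T u)%R) ->
  asymp_equiv
    (fun u : R => lne (P [set w | u%:E < min_workload X (T u) w]))
    (fun u : R => - (u * theta_star)%:E - (T u)%:E * rate X 1%R).
Proof.
move=> levyX EX0 _; set th := theta_star => th0 thbeta cth T0.
have [b thb Mb] : exists2 b, (th < b)%R & mgf_net X 1 b < +oo.
  have [_ [b /= Mb <-]] := ereal_sup_gt thbeta.
  rewrite lte_fin => thb; exists b => //.
  by rewrite mgf_net1E lte_mul_pinfty// lee_fin expR_ge0.
have [I rI I0] := rate_fin EX0 Mb th0 thb cth.
pose p u := fine (P [set w | u%:E < min_workload X (T u) w]).
pose G u := (th * u + T u * I)%R.
have pE u : (0 < u)%R -> P [set w | u%:E < min_workload X (T u) w] = (p u)%:E.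
  move=> u0; rewrite /p fineK// fin_num_measure//.
  by apply: measurable_min_workload => //; [exact: ltW|exact: T0].
have G0 u : (0 < u)%R -> (th * u <= G u)%R.
  by move=> u0; rewrite lerDl mulr_ge0 ?T0// ltW.
have p_lower (e : R) : (0 < e)%R -> exists C : R, forall u : R, (0 < u)%R ->
    (expR (- ((1 + e) * G u + C)) <= p u)%R.
  move=> e0; have [C HC] := overflow_lower levyX EX0 Mb th0 thb cth rI I0 e0.
  by exists C => u u0; rewrite -lee_fin -pE//; apply: HC; [exact: ltW|exact: T0].
have p_upper u : (0 < u)%R -> (p u <= expR (I - G u))%R.
  move=> u0; rewrite -lee_fin -pE//.
  by apply: (overflow_upper levyX EX0 Mb th0 thb cth rI I0); [exact: ltW|exact: T0].
have p_gt0 u : (0 < u)%R -> (0 < p u)%R.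
  by move=> u0; have [C /(_ u u0)] := p_lower 1%R ltr01; apply: lt_le_trans; exact: expR_gt0.
pose r u := (- ln (p u) / G u)%R.
rewrite /asymp_equiv.
(* Convergence is proved for the real quotient [r]. It agrees with the extended one as soon as
   [u > 0], where the probability is positive and [G u] is nonzero. *)
have rE : \forall u \near +oo%R, (r u)%:E =
    lne (P [set w | u%:E < min_workload X (T u) w]) /
    (- (u * th)%:E - (T u)%:E * rate X 1%R).
  near=> u; have u0 : (0 < u)%R by near: u; exact: nbhs_pinfty_gt.
  have Gu : (0 < G u)%R by apply: lt_le_trans (G0 u u0); rewrite mulr_gt0.
  rewrite pE// lne_EFin ?p_gt0// rI -EFinM -EFinN -EFinB.
  have -> : (- (u * th) - T u * I = - G u)%R by rewrite /G; ring.
  rewrite inver oppr_eq0 gt_eqF// -EFinM; congr EFin.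
  by rewrite /r invrN mulrN mulNr.
apply: cvg_trans (near_eq_cvg rE) _.
apply: cvg_EFin; first by near=> u.
apply/cvgrPdist_le => e e0.
have e20 : (0 < e / 2)%R by rewrite divr_gt0.
have [C HC] := p_lower _ e20.
near=> u.
have u0 : (0 < u)%R by near: u; exact: nbhs_pinfty_gt.
(* Because [G u >= th * u], these thresholds, which do not involve [T], give [I <= e * G u] and
   [C <= e / 2 * G u]. *)
have u1 : (I / (e * th) <= u)%R by near: u; exact/nbhs_pinfty_ge/num_real.
have u2 : (`|C| / (e / 2 * th) <= u)%R by near: u; exact/nbhs_pinfty_ge/num_real.
have Gu : (0 < G u)%R by apply: lt_le_trans (G0 u u0); rewrite mulr_gt0.
have := p_upper u u0; have := HC u u0.
rewrite -[X in (_ <= X)%R -> _]lnK ?posrE ?p_gt0// ler_expR => lo.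
rewrite -[X in (X <= _)%R -> _]lnK ?posrE ?p_gt0// ler_expR => up.
have eI : (I <= e * G u)%R.
  rewrite ler_pdivrMr ?mulr_gt0// in u1; apply: (le_trans u1).
  have -> : (u * (e * th) = e * (th * u))%R by ring.
  by rewrite ler_wpM2l ?G0// ltW.
have eC : (`|C| <= e / 2 * G u)%R.
  rewrite ler_pdivrMr ?mulr_gt0// in u2; apply: (le_trans u2).
  have -> : (u * (e / 2 * th) = e / 2 * (th * u))%R by ring.
  by rewrite ler_wpM2l ?G0// ltW.
have CC := ler_norm C.
have rG : (r u * G u = - ln (p u))%R by rewrite /r divfK// gt_eqF.
rewrite ler_norml; apply/andP; split.
  rewrite -(ler_pM2r Gu) mulrBl rG; lra.
rewrite -(ler_pM2r Gu) mulrBl rG; lra.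
Unshelve. all: by end_near. Qed.
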